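(* Let $n$ be a positive integer, let $K$ be a field of characteristic $0$ containing a primitive $4$th root of unity $i$, let $F=K(\alpha_k,\beta_k : 1\le k\le n)$ be the function field in $2n$ algebraically independent variables $\alpha_1,\beta_1,\dots,\alpha_n,\beta_n$ over $K$, and let $A=\bigotimes_{k=1}^n(\alpha_k,\beta_k)_{4,F}$ (tensor product over $F$) be the generic tensor product of $n$ cyclic algebras of degree $4$. Then the maximal dimension over $F$ of a Kummer space in $A$ is $4n+1$.
   Context: For $\alpha,\beta\in F^\times$, the cyclic (symbol) algebra of degree $4$ over $F$ is $(\alpha,\beta)_{4,F}=F\langle x,y : x^4=\alpha,\ y^4=\beta,\ xy=i\,yx\rangle$, where $i$ is a fixed primitive $4$th root of unity in $F$. An element $v\in A$ is called Kummer if $v^4\in F$. An $F$-vector subspace of $A$ is called Kummer (a Kummer space) if all of its elements are Kummer. *)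

(* Defs.v *)
From HB Require Import structures.
From mathcomp Require Import all_boot all_order all_algebra all_field.
From mathcomp Require Import mpoly ring zify.

Set Implicit Arguments.
Unset Strict Implicit.
Unset Printing Implicit Defensive.

Import GRing.Theory.
Local Open Scope ring_scope.

(* (a, b)_{4,F} = F<x, y : x^4 = a, y^4 = b, x y = z (y x)>, on the basis of   *)
(* the monomials x^k y^l, k, l < 4; the coefficient of x^k y^l is the (k, l)   *)
(* entry, and the product is symbol_mul, not the matrix product.               *)
(* symbol_presentation below is the universal property of this presentation.   *)
Definition symbol_alg (F : fieldType) (z : F) of 4.-primitive_root z
  & F & F : Type := 'M[F]_(4, 4).

Section SymbolAlgebra.

Variables (F : fieldType) (z : F) (zP : 4.-primitive_root z) (a b : F).
Local Notation S := (symbol_alg zP a b).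

HB.instance Definition _ := Vector.copy S 'M[F]_(4, 4).

(* x^k y^l, for arbitrary exponents *)
Definition symbol_mon (k l : nat) : S :=
  (a ^+ (k %/ 4) * b ^+ (l %/ 4)) *:
    (delta_mx (inord (k %% 4)) (inord (l %% 4)) : 'M[F]_(4, 4)).

(* (x^k y^l) (x^k' y^l') = z^(- l k') x^(k + k') y^(l + l') *)
Definition symbol_mul (u v : S) : S :=
  \sum_(k < 4) \sum_(l < 4) \sum_(k' < 4) \sum_(l' < 4)
    (u k l * v k' l') *: (z ^- (l * k') *: symbol_mon (k + k') (l + l')).

Definition symbol_x : S := symbol_mon 1 0.
Definition symbol_y : S := symbol_mon 0 1.

Local Notation mon := symbol_mon.
Local Notation mul := symbol_mul.

Let z4 : z ^+ 4 = 1. Proof. exact: prim_expr_order zP. Qed.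
Let z_unit : z \is a GRing.unit.
Proof. by rewrite unitfE; apply/eqP=> z0; move/eqP: z4; rewrite z0 expr0n eq_sym oner_eq0. Qed.

Fact symbol_monE (k l : 'I_4) : mon k l = delta_mx k l :> 'M[F]_(4, 4).
Proof.
by rewrite /mon !divn_small // !modn_small // !expr0 mul1r scale1r !inord_val.
Qed.

Fact symbol_monDl m k l : mon (m * 4 + k) l = a ^+ m *: mon k l.
Proof. by rewrite /mon divnMDl // modnMDl scalerA exprD -!mulrA. Qed.

Fact symbol_monDr m k l : mon k (m * 4 + l) = b ^+ m *: mon k l.
Proof. by rewrite /mon divnMDl // modnMDl scalerA exprD mulrCA. Qed.

Fact symbol_mon_red k l :
  mon k l = (a ^+ (k %/ 4) * b ^+ (l %/ 4)) *: mon (k %% 4) (l %% 4).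
Proof.
by rewrite {1}(divn_eq k 4) {1}(divn_eq l 4) symbol_monDl symbol_monDr scalerA.
Qed.

Fact symbol_sum (u : S) : u = \sum_(k < 4) \sum_(l < 4) u k l *: mon k l.
Proof.
rewrite [LHS](matrix_sum_delta (u : 'M[F]_(4, 4))).
by apply: eq_bigr => k _; apply: eq_bigr => l _; rewrite symbol_monE.
Qed.

Fact symbol_mul_linearl v : linear (mul^~ v).
Proof.
move=> c u w; rewrite /mul; do 4!(rewrite scaler_sumr -big_split /=;
  apply: eq_bigr => ? _).
by rewrite !mxE mulrDl scalerDl !scalerA -!mulrA.
Qed.

Fact symbol_mul_linearr u : linear (mul u).
Proof.
move=> c v w; rewrite /mul; do 4!(rewrite scaler_sumr -big_split /=;
  apply: eq_bigr => ? _).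
by rewrite !mxE mulrDr scalerDl mulrCA -!scalerA.
Qed.

Fact symbol_mulDl u v w : mul (u + v) w = mul u w + mul v w.
Proof. by apply: (GRing.semilinear_linear (symbol_mul_linearl w)).2. Qed.
Fact symbol_mulDr u v w : mul u (v + w) = mul u v + mul u w.
Proof. by apply: (GRing.semilinear_linear (symbol_mul_linearr u)).2. Qed.
Fact symbol_mulZl c u v : mul (c *: u) v = c *: mul u v.
Proof. exact: (GRing.semilinear_linear (symbol_mul_linearl v)).1. Qed.
Fact symbol_mulZr c u v : mul u (c *: v) = c *: mul u v.
Proof. exact: (GRing.semilinear_linear (symbol_mul_linearr u)).1. Qed.

Fact symbol_mul_mon_small (k l k' l' : 'I_4) :
  mul (mon k l) (mon k' l') = z ^- (l * k') *: mon (k + k') (l + l').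
Proof.
rewrite /mul (bigD1 k) //= (bigD1 l) //= (bigD1 k') //= (bigD1 l') //=.
rewrite !symbol_monE !mxE !eqxx /= mulr1 scale1r.
rewrite big1 => [|j /negPf nj]; last first.
  by rewrite !mxE nj !andbF mulr0 scale0r.
rewrite big1 => [|j /negPf nj]; last first.
  by rewrite big1 // => ? _; rewrite !mxE nj mulr0 scale0r.
rewrite big1 => [|j /negPf nj]; last first.
  by rewrite big1 // => ? _; rewrite big1 // => ? _; rewrite !mxE nj andbF mul0r scale0r.
rewrite big1 => [|j /negPf nj]; last first.
  do 3!(rewrite big1 // => ? _); by rewrite !mxE nj mul0r scale0r.
by rewrite !addr0.
Qed.

Fact symbol_mul_mon k l k' l' :
  mul (mon k l) (mon k' l') = z ^- (l * k') *: mon (k + k') (l + l').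
Proof.
have lt4 m : (m %% 4 < 4)%N by rewrite ltn_mod.
rewrite (symbol_mon_red k) (symbol_mon_red k') symbol_mulZl symbol_mulZr.
rewrite (symbol_mul_mon_small (Ordinal (lt4 k)) (Ordinal (lt4 l))
  (Ordinal (lt4 k')) (Ordinal (lt4 l'))) /=.
have -> : z ^- (l %% 4 * (k' %% 4)) = z ^- (l * k').
  by rewrite -(expr_mod _ z4) modnMml modnMmr (expr_mod _ z4).
have -> : mon (k + k') (l + l') =
   (a ^+ (k %/ 4 + k' %/ 4) * b ^+ (l %/ 4 + l' %/ 4)) *:
     mon (k %% 4 + k' %% 4) (l %% 4 + l' %% 4).
  rewrite {1}(divn_eq k 4) {1}(divn_eq k' 4) {1}(divn_eq l 4) {1}(divn_eq l' 4).
  by rewrite addnACA -mulnDl addnACA -mulnDl symbol_monDl symbol_monDr scalerA.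
rewrite !scalerA !exprD; congr (_ *: _).
by ring.
Qed.

Fact symbol_mon_ind (P : S -> Prop) :
  (forall c u v, P u -> P v -> P (c *: u + v)) -> (forall k l, P (mon k l)) ->
  forall u, P u.
Proof.
move=> Plin Pmon u; have P0 : P 0.
  by have := Plin (-1) _ _ (Pmon 0%N 0%N) (Pmon 0%N 0%N); rewrite scaleN1r addNr.
rewrite [u]symbol_sum; apply: big_rec => // k v _ Pv.
rewrite -[X in P (X + v)]scale1r; apply: (Plin) => //.
by apply: big_rec => // l w _ Pw; apply: (Plin) => //; apply: Pmon.
Qed.

Fact symbol_mulA : associative mul.
Proof.
move=> u v w; move: u; apply: symbol_mon_ind => [c u u' Hu Hu'|k l].
  by rewrite !symbol_mulDl !symbol_mulZl Hu Hu'.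
move: v; apply: symbol_mon_ind => [c v v'|k' l'].
  move: (mon k l) => m Hv Hv'.
  by rewrite symbol_mulDl symbol_mulZl !symbol_mulDr !symbol_mulZr symbol_mulDl symbol_mulZl Hv Hv'.
move: w; apply: symbol_mon_ind => [c w w'|k2 l2].
  move: (mon k l) (mon k' l') => m m' Hw Hw'.
  by rewrite !symbol_mulDr !symbol_mulZr Hw Hw'.
rewrite symbol_mul_mon symbol_mulZr symbol_mul_mon.
rewrite symbol_mul_mon symbol_mulZl symbol_mul_mon !scalerA !addnA.
congr (_ *: _); rewrite -!invfM -!exprD; congr (_ ^- _ * _).
by rewrite mulnDl mulnDr; lia.
Qed.

Fact symbol_mul1l : left_id (mon 0 0) mul.
Proof.
apply: symbol_mon_ind => [c u v Hu Hv|k l].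
  by rewrite symbol_mulDr symbol_mulZr Hu Hv.
by rewrite symbol_mul_mon mul0n expr0 invr1 scale1r.
Qed.

Fact symbol_mul1r : right_id (mon 0 0) mul.
Proof.
apply: symbol_mon_ind => [c u v Hu Hv|k l].
  by rewrite symbol_mulDl symbol_mulZl Hu Hv.
by rewrite symbol_mul_mon muln0 expr0 invr1 scale1r !addn0.
Qed.

Fact symbol_1_neq0 : mon 0 0 != 0.
Proof.
apply/eqP=> /matrixP/(_ 0 0)/eqP.
by rewrite (symbol_monE 0 0) !mxE eqxx oner_eq0.
Qed.

HB.instance Definition _ := GRing.Zmodule_isNzRing.Build S
  symbol_mulA symbol_mul1l symbol_mul1r symbol_mulDl symbol_mulDr symbol_1_neq0.

HB.instance Definition _ := GRing.Lmodule_isLalgebra.Build F S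
  (fun c u v => esym (symbol_mulZl c u v)).
HB.instance Definition _ := GRing.Lalgebra_isAlgebra.Build F S
  (fun c u v => esym (symbol_mulZr c u v)).
HB.instance Definition _ := Algebra_isFalgebra.Build F S.

Fact symbol_monM k l k' l' :
  mon k l * mon k' l' = z ^- (l * k') *: mon (k + k') (l + l').
Proof. exact: symbol_mul_mon. Qed.

Fact symbol_x_exp k : symbol_x ^+ k = mon k 0.
Proof.
by elim: k => // k IHk; rewrite exprS IHk symbol_monM mul0n invr1 scale1r.
Qed.

Fact symbol_y_exp l : symbol_y ^+ l = mon 0 l.
Proof.
by elim: l => // l IHl; rewrite exprS IHl symbol_monM muln0 invr1 scale1r.
Qed.

Lemma symbol_monXY k l : mon k l = symbol_x ^+ k * symbol_y ^+ l.
Proof.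
by rewrite symbol_x_exp symbol_y_exp symbol_monM mul0n invr1 scale1r addn0.
Qed.

Lemma symbol_x4 : symbol_x ^+ 4 = a%:A.
Proof. by rewrite symbol_x_exp -[LHS]/(mon (1 * 4 + 0) 0) symbol_monDl expr1. Qed.

Lemma symbol_y4 : symbol_y ^+ 4 = b%:A.
Proof. by rewrite symbol_y_exp -[LHS]/(mon 0 (1 * 4 + 0)) symbol_monDr expr1. Qed.

Lemma symbol_xy : symbol_x * symbol_y = z *: (symbol_y * symbol_x).
Proof.
rewrite /symbol_x /symbol_y !symbol_monM mul0n expr0 invr1 scale1r expr1.
by rewrite scalerA divff ?scale1r // -unitfE.
Qed.

Section Presentation.

Variables (B : algType F) (X Y : B).
Hypotheses (X4 : X ^+ 4 = a%:A) (Y4 : Y ^+ 4 = b%:A) (XY : X * Y = z *: (Y * X)).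

Let ev (u : S) : B := \sum_(k < 4) \sum_(l < 4) u k l *: (X ^+ k * Y ^+ l).

Let ev_linear : linear ev.
Proof.
move=> c u v; rewrite /ev; do 2!(rewrite scaler_sumr -big_split /=;
  apply: eq_bigr => ? _).
by rewrite !mxE scalerDl scalerA.
Qed.

Let evD u v : ev (u + v) = ev u + ev v.
Proof. exact: (GRing.semilinear_linear ev_linear).2. Qed.
Let evZ c u : ev (c *: u) = c *: ev u.
Proof. exact: (GRing.semilinear_linear ev_linear).1. Qed.

Let ev_small (k l : 'I_4) : ev (mon k l) = X ^+ k * Y ^+ l.
Proof.
rewrite /ev (bigD1 k) //= (bigD1 l) //= symbol_monE !mxE !eqxx scale1r.
rewrite big1 => [|j /negPf nj]; last by rewrite !mxE nj andbF scale0r.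
rewrite big1 => [|j /negPf nj]; last first.
  by rewrite big1 // => ? _; rewrite !mxE nj scale0r.
by rewrite !addr0.
Qed.

Let ev_mon k l : ev (mon k l) = X ^+ k * Y ^+ l.
Proof.
have lt4 m : (m %% 4 < 4)%N by rewrite ltn_mod.
rewrite symbol_mon_red evZ (ev_small (Ordinal (lt4 k)) (Ordinal (lt4 l))) /=.
rewrite [in RHS](divn_eq k 4) [in RHS](divn_eq l 4) !exprD ![(_ * 4)%N]mulnC !exprM.
rewrite X4 Y4 !exprZn !expr1n -!scalerAl !mul1r -scalerAr.
by rewrite -scalerA.
Qed.

Let YX : Y * X = z^-1 *: (X * Y).
Proof. by rewrite XY scalerA mulVr ?scale1r. Qed.

Let YXn k : Y * X ^+ k = z ^- k *: (X ^+ k * Y).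
Proof.
elim: k => [|k IHk]; first by rewrite !expr0 mulr1 mul1r invr1 scale1r.
rewrite exprSr mulrA IHk -scalerAl -[_ * Y * X]mulrA YX -scalerAr scalerA mulrA.
by rewrite exprSr invfM mulrC.
Qed.

Let YnXn l k : Y ^+ l * X ^+ k = z ^- (l * k) *: (X ^+ k * Y ^+ l).
Proof.
elim: l => [|l IHl]; first by rewrite !expr0 mulr1 mul1r invr1 scale1r.
rewrite exprSr -[_ * Y * X ^+ k]mulrA YXn -scalerAr [Y ^+ l * (_ * _)]mulrA IHl.
rewrite -scalerAl scalerA mulrA.
by rewrite mulSn exprD invfM.
Qed.

Let ev_mul : monoid_morphism ev.
Proof.
split=> [|u v]; first by rewrite -[1]/(mon 0 0) ev_mon mulr1.
move: u; apply: symbol_mon_ind => [c u u' Hu Hu'|k l].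
  by rewrite mulrDl -scalerAl !evD !evZ Hu Hu' mulrDl scalerAl.
move: v; apply: symbol_mon_ind => [c v v'|k' l'].
  move: (mon k l) => m Hv Hv'.
  by rewrite mulrDr -scalerAr !evD !evZ Hv Hv' mulrDr scalerAr.
rewrite symbol_monM evZ !ev_mon mulrA -[_ * _ * X ^+ _]mulrA YnXn.
by rewrite -scalerAr -scalerAl !exprD !mulrA.
Qed.

Let ev_lr : {lrmorphism S -> B} := HB.pack ev
  (GRing.isSemilinear.Build F S B _ ev (GRing.semilinear_linear ev_linear))
  (GRing.isMonoidMorphism.Build S B ev ev_mul).

Lemma symbol_presentation :
  (exists f : {lrmorphism S -> B}, f symbol_x = X /\ f symbol_y = Y) /\
  (forall f g : {lrmorphism S -> B},
     f symbol_x = g symbol_x -> f symbol_y = g symbol_y -> f =1 g).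
Proof.
split.
  by exists ev_lr; rewrite /= /symbol_x /symbol_y !ev_mon !expr1 !expr0 mulr1 mul1r.
move=> f g fgx fgy; apply: symbol_mon_ind => [c u v Hu Hv|k l].
  by rewrite [LHS]linearP [RHS]linearP; congr (_ *: _ + _).
rewrite symbol_monXY [LHS]rmorphM [RHS]rmorphM.
by congr (_ * _); rewrite [LHS]rmorphXn [RHS]rmorphXn; congr (_ ^+ _).
Qed.

End Presentation.

End SymbolAlgebra.

Import VectorInternalTheory.

(* The coordinates of an element of A (x) B in the product of the bases of A   *)
(* and B.  tensor_universal and tensor_alg_universal below are the universal   *)
(* properties of A (x) B as a vector space and as an algebra.                  *)
Definition tensor (F : fieldType) (A B : falgType F) : Type :=
  'M[F]_(dim A, dim B).

Section TensorSpace.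

Variables (F : fieldType) (A B : falgType F).
Local Notation T := (tensor A B).

HB.instance Definition _ := Vector.copy T 'M[F]_(dim A, dim B).

Definition tens (u : A) (v : B) : T := (v2r u)^T *m v2r v.

Definition bilin (V : lmodType F) (f : A -> B -> V) :=
  (forall v, linear (f^~ v)) /\ (forall u, linear (f u)).

(* the linear map sending u (x) v to f u v, for bilinear f *)
Definition tens_lift (V : lmodType F) (f : A -> B -> V) (t : T) : V :=
  \sum_i \sum_j t i j *: f (r2v (delta_mx 0 i)) (r2v (delta_mx 0 j)).

Fact tensE u v i j : tens u v i j = v2r u 0 i * v2r v 0 j.
Proof. by rewrite !mxE big_ord1 !mxE. Qed.

Fact tensor_linE c (t t' : T) i j : (c *: t + t') i j = c * t i j + t' i j.
Proof. by rewrite !mxE. Qed.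

Lemma tens_bilin : bilin tens.
Proof.
split=> [v|u] c x y; apply/matrixP=> i j; rewrite tensor_linE !tensE linearP !mxE.
  by rewrite mulrDl mulrA.
by rewrite mulrDr mulrCA.
Qed.

Section Lift.

Variables (V : lmodType F) (f : A -> B -> V).

Fact tens_lift_linear : linear (tens_lift f).
Proof.
move=> c t t'; rewrite /tens_lift; do 2!(rewrite scaler_sumr -big_split /=;
  apply: eq_bigr => ? _).
by rewrite !mxE scalerDl scalerA.
Qed.

Definition tens_lift_lin : {linear T -> V} := HB.pack (tens_lift f)
  (GRing.isSemilinear.Build F T V _ (tens_lift f)
    (GRing.semilinear_linear tens_lift_linear)).

Lemma tens_liftE u v : bilin f -> tens_lift f (tens u v) = f u v.
Proof.
move=> [fl fr].
have bE (C : falgType F) (w : C) :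
    w = \sum_i v2r w 0 i *: r2v (delta_mx 0 i).
  rewrite -[LHS]v2rK [in LHS](row_sum_delta (v2r w)) linear_sum.
  by apply: eq_bigr => i _; rewrite linearZ.
pose gl w : {linear A -> V} := HB.pack (f^~ w)
  (GRing.isSemilinear.Build F A V _ (f^~ w) (GRing.semilinear_linear (fl w))).
pose gr w : {linear B -> V} := HB.pack (f w)
  (GRing.isSemilinear.Build F B V _ (f w) (GRing.semilinear_linear (fr w))).
rewrite [in RHS](bE _ u) -[RHS]/(gl v _) linear_sum; apply: eq_bigr => i _.
rewrite linearZ_LR /= -/(gr _ v) [in RHS](bE _ v).
rewrite -[f _ _]/(gr _ _) linear_sum scaler_sumr; apply: eq_bigr => j _.
by rewrite linearZ_LR /= tensE scalerA.
Qed.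

End Lift.

Fact tens_ind (P : T -> Prop) :
  (forall c t t', P t -> P t' -> P (c *: t + t')) -> (forall u v, P (tens u v)) ->
  forall t, P t.
Proof.
move=> Plin Pt t; have P0 : P 0.
  by have := Plin (-1) _ _ (Pt 0 0) (Pt 0 0); rewrite scaleN1r addNr.
rewrite [t](matrix_sum_delta (t : 'M[F]_(dim A, dim B))).
apply: big_rec => // i t1 _ Pt1; rewrite -[X in P (X + t1)]scale1r.
apply: (Plin) => //; apply: big_rec => // j t2 _ Pt2; apply: (Plin) => //.
suff <- : tens (r2v (delta_mx 0 i)) (r2v (delta_mx 0 j)) = delta_mx i j.
  exact: Pt.
by apply/matrixP=> k l; rewrite tensE !r2vK !mxE /= -natrM mulnb.
Qed.

Lemma tensor_universal (V : lmodType F) (f : A -> B -> V) : bilin f ->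
  (exists h : {linear T -> V}, forall u v, h (tens u v) = f u v) /\
  (forall h h' : {linear T -> V},
     (forall u v, h (tens u v) = h' (tens u v)) -> h =1 h').
Proof.
move=> fP; split; first by exists (tens_lift_lin f) => u v; apply: tens_liftE.
move=> h h' hh'; apply: tens_ind => [c t t' Ht Ht'|//].
by rewrite [LHS]linearP [RHS]linearP; congr (_ *: _ + _).
Qed.

Fact tens_neq0 u v : u != 0 -> v != 0 -> tens u v != 0.
Proof.
move=> u0 v0; have [i ui] : exists i, v2r u 0 i != 0.
  by apply/rV0Pn; apply: contra_neq u0 => u0; apply: v2r_inj; rewrite u0 linear0.
have [j vj] : exists j, v2r v 0 j != 0.
  by apply/rV0Pn; apply: contra_neq v0 => v0; apply: v2r_inj; rewrite v0 linear0.
apply/eqP=> /matrixP/(_ i j)/eqP; rewrite tensE !mxE mulf_eq0.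
by rewrite (negPf ui) (negPf vj).
Qed.

End TensorSpace.

Section TensorAlgebra.

Variables (F : fieldType) (A B : falgType F).
Local Notation T := (tensor A B).

(* (u (x) v) (u' (x) v') = (u u') (x) (v v') *)
Definition tensor_mul (t t' : T) : T :=
  tens_lift (fun u v => tens_lift (fun u' v' => tens (u * u') (v * v')) t') t.

Local Notation mul := tensor_mul.

Let tensDl c u u' v : tens (c *: u + u') v = c *: tens u v + tens u' v :> T.
Proof. exact: (tens_bilin A B).1. Qed.
Let tensDr c u v v' : tens u (c *: v + v') = c *: tens u v + tens u v' :> T.
Proof. exact: (tens_bilin A B).2. Qed.

Let mulr_bilin u v : bilin (fun u' v' => tens (u * u') (v * v') : T).
Proof.
split=> [v'|u'] c x y; rewrite mulrDr -scalerAr; first exact: tensDl.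
exact: tensDr.
Qed.

Let mull_bilin t : bilin (fun u v =>
  tens_lift (fun u' v' => tens (u * u') (v * v') : T) t).
Proof.
split=> [v|u] c x y; rewrite /tens_lift;
  do 2!(rewrite scaler_sumr -big_split /=; apply: eq_bigr => ? _);
  rewrite mulrDl -scalerAl ?tensDl ?tensDr scalerDr !scalerA.
  by rewrite [c * _]mulrC.
by rewrite [c * _]mulrC.
Qed.

Fact tensor_mulE u v u' v' :
  mul (tens u v) (tens u' v') = tens (u * u') (v * v').
Proof. by rewrite /mul tens_liftE ?tens_liftE. Qed.

Fact tensor_mulPl t c t1 t2 : mul (c *: t1 + t2) t = c *: mul t1 t + mul t2 t.
Proof. exact: tens_lift_linear. Qed.

Fact tensor_mulPr t c t1 t2 : mul t (c *: t1 + t2) = c *: mul t t1 + mul t t2.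
Proof.
move: t; apply: tens_ind => [d t t' Ht Ht'|u v].
  by rewrite !tensor_mulPl Ht Ht' !scalerDr !scalerA addrACA [c * d]mulrC.
by rewrite /mul !tens_liftE // tens_lift_linear.
Qed.

Fact tensor_mulDl : left_distributive mul +%R.
Proof. by move=> t t' s; have := tensor_mulPl s 1 t t'; rewrite !scale1r. Qed.
Fact tensor_mulDr : right_distributive mul +%R.
Proof. by move=> s t t'; have := tensor_mulPr s 1 t t'; rewrite !scale1r. Qed.
Fact tensor_mulZl c t s : c *: mul t s = mul (c *: t) s.
Proof. by rewrite [RHS](GRing.semilinear_linear (tensor_mulPl s)).1. Qed.
Fact tensor_mulZr c s t : c *: mul s t = mul s (c *: t).
Proof. by rewrite [RHS](GRing.semilinear_linear (tensor_mulPr s)).1. Qed.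

Fact tensor_mulA : associative mul.
Proof.
move=> t s r; move: t; apply: tens_ind => [c t t' Ht Ht'|u v].
  by rewrite !tensor_mulPl Ht Ht'.
move: s; apply: tens_ind => [c s s' Hs Hs'|u' v'].
  by rewrite tensor_mulPl !tensor_mulPr tensor_mulPl Hs Hs'.
move: r; apply: tens_ind => [c r r' Hr Hr'|u2 v2].
  by rewrite !tensor_mulPr Hr Hr'.
by rewrite !tensor_mulE !mulrA.
Qed.

Fact tensor_mul1l : left_id (tens 1 1) mul.
Proof.
apply: tens_ind => [c t t' Ht Ht'|u v]; first by rewrite tensor_mulPr Ht Ht'.
by rewrite tensor_mulE !mul1r.
Qed.

Fact tensor_mul1r : right_id (tens 1 1) mul.
Proof.
apply: tens_ind => [c t t' Ht Ht'|u v]; first by rewrite tensor_mulPl Ht Ht'.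
by rewrite tensor_mulE !mulr1.
Qed.

Fact tensor_1_neq0 : tens 1 1 != 0 :> T.
Proof. by rewrite tens_neq0 ?oner_neq0. Qed.

HB.instance Definition _ := GRing.Zmodule_isNzRing.Build T
  tensor_mulA tensor_mul1l tensor_mul1r tensor_mulDl tensor_mulDr tensor_1_neq0.
HB.instance Definition _ := GRing.Lmodule_isLalgebra.Build F T tensor_mulZl.
HB.instance Definition _ := GRing.Lalgebra_isAlgebra.Build F T tensor_mulZr.
HB.instance Definition _ := Algebra_isFalgebra.Build F T.

Lemma tensM u v u' v' : tens u v * tens u' v' = tens (u * u') (v * v') :> T.
Proof. exact: tensor_mulE. Qed.

Lemma tens11 : tens 1 1 = 1 :> T.
Proof. by []. Qed.

Lemma tensor_alg_universal (C : algType F)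
    (f : {lrmorphism A -> C}) (g : {lrmorphism B -> C}) :
  (forall u v, f u * g v = g v * f u) ->
  (exists h : {lrmorphism T -> C}, forall u v, h (tens u v) = f u * g v) /\
  (forall h h' : {lrmorphism T -> C},
     (forall u, h (tens u 1) = h' (tens u 1)) ->
     (forall v, h (tens 1 v) = h' (tens 1 v)) -> h =1 h').
Proof.
move=> fgC; have fgP : bilin (fun u v => f u * g v).
  split=> [v|u] c x y; rewrite linearP; first by rewrite mulrDl scalerAl.
  by rewrite mulrDr scalerAr.
split.
  have hM : monoid_morphism (tens_lift (fun u v => f u * g v)).
    split=> [|t s]; first by rewrite -tens11 tens_liftE // !rmorph1 mulr1.
    move: t; apply: tens_ind => [c t t' Ht Ht'|u v].
      by rewrite mulrDl -scalerAl !tens_lift_linear Ht Ht' mulrDl scalerAl.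
    move: s; apply: tens_ind => [c s s' Hs Hs'|u' v'].
      by rewrite mulrDr -scalerAr !tens_lift_linear Hs Hs' mulrDr scalerAr.
    rewrite tensM !tens_liftE // !rmorphM !mulrA.
    by rewrite -[f u * g v * f u']mulrA -fgC mulrA.
  pose h : {lrmorphism T -> C} := HB.pack (tens_lift (fun u v => f u * g v))
    (GRing.isSemilinear.Build F T C _ _ (GRing.semilinear_linear
       (tens_lift_linear (fun u v => f u * g v))))
    (GRing.isMonoidMorphism.Build T C _ hM).
  by exists h => u v; apply: tens_liftE.
move=> h h' hf hg; apply: tens_ind => [c t t' Ht Ht'|u v].
  by rewrite [LHS]linearP [RHS]linearP; congr (_ *: _ + _).
rewrite -[u]mulr1 -[v in tens _ v]mul1r -tensM [LHS]rmorphM [RHS]rmorphM.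
by congr (_ * _); [apply: hf | apply: hg].
Qed.

End TensorAlgebra.

(* A_0 (x) (A_1 (x) (... (x) (A_(n - 1) (x) F))) *)
Fixpoint tensor_prod (F : fieldType) (n : nat) :
    ('I_n -> falgType F) -> falgType F :=
  match n with
  | 0 => fun _ => F^o
  | n'.+1 => fun A => tensor (A ord0) (tensor_prod (fun k => A (lift ord0 k)))
  end.

Section Generic.

Variables (K : fieldType) (n : nat).

(* K(alpha_k, beta_k : k < n) *)
Definition generic_field : fieldType := {fraction {mpoly K[n + n]}}.

Definition generic_const (c : K) : generic_field :=
  tofrac (c%:MP : {mpoly K[n + n]}).
Definition generic_alpha (k : 'I_n) : generic_field :=
  tofrac ('X_(lshift n k) : {mpoly K[n + n]}).
Definition generic_beta (k : 'I_n) : generic_field :=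
  tofrac ('X_(rshift n k) : {mpoly K[n + n]}).

Fact generic_prim_root (i : K) :
  4.-primitive_root i -> 4.-primitive_root (generic_const i).
Proof.
by rewrite -(fmorph_primitive_root (@tofrac _ \o @mpolyC (n + n) K)).
Qed.

Definition generic_alg (i : K) (iP : 4.-primitive_root i) :
    falgType generic_field :=
  tensor_prod (fun k =>
    symbol_alg (generic_prim_root iP) (generic_alpha k) (generic_beta k)).

End Generic.

Definition kummer (F : fieldType) (A : falgType F) (v : A) := v ^+ 4 \in 1%VS.

Definition kummer_space (F : fieldType) (A : falgType F) (V : {vspace A}) :=
  forall v, v \in V -> kummer v.

(* Main.v *)
Require Import Defs.
From mathcomp Require Import all_boot all_order all_algebra all_field.
From HB Require Import structures.
From mathcomp Require Import mpoly ring zify generic_quotient.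

Set Implicit Arguments.
Unset Strict Implicit.
Unset Printing Implicit Defensive.

Import Order.TTheory GRing.Theory Num.Theory.
Local Open Scope ring_scope.

(** Lower bound.  If x, y are the standard generators of one symbol algebra and
    V' is a Kummer space in the product of the remaining ones, then so is
    F[x] y (x) 1 + x (x) V': an element is a sum p + q with
    q p = i p q, hence (p + q)^4 = p^4 + q^4 (expr4_quasi); q^4 is a scalar
    because V' is Kummer, and p^4 = (f(x) y)^4 is y^4 times the norm of f(x)
    down to F (twist_kummer).  Each factor adds 4 to the dimension, starting
    from V = F.

    Upper bound.  Over the polynomial ring in the alpha_k, beta_k, the algebra
    is a quantum polynomial ring: it is spanned over K by monomials indexed by
    exponents in N^(2n), two of which multiply to a power of i times the
    monomial of the sum of the exponents.  For a monomial order on N^(2n),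
    every element that is cleared of denominators has a leading exponent, and
    leading monomials are multiplicative.  A space of dimension d has at least
    d leading exponents that are distinct modulo 4 (leading_family), since a
    nonzero element has a nonzero coordinate at its leading residue.

    In characteristic 0 the condition v^4 in F polarizes to conditions on two
    or three elements of V, which Jordan products x y + y x express as
    jord31, jord22 and jord211.  Read on leading monomials, they say: two
    distinct leading residues do not commute; if they anticommute they agree
    modulo 2; and if the commutation exponents from a to b and from b to c are
    1 modulo 4, then so is the one from a to c, unless a + 2 b + c = 0 modulo 4
    (leading_commute, leading_anticommute, leading_path).

    A finite family in (Z/4)^N with an alternating form and these properties
    has at most 2 N + 1 members (kummer_family_card), where N = 2 n here.
    Members that agree modulo 2 come at most in pairs.  Members of distinct
    classes pair to 1 modulo 2, so their Gram matrix over F_2 is U - 1, with U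
    the all-one matrix, and there are at most N + 1 classes.  If the bound were
    exceeded, there would be exactly N + 1 classes and all would be pairs
    b, b + 2 d.  The sum of all classes is then in the radical of the form, so
    the matrix f i j of the form at (d_i, b_j) modulo 2 has zero row sums; its
    diagonal is 1, and the third property makes it symmetric.  In characteristic
    2 the sum of all entries of a symmetric matrix is its trace, so N + 1 = 0
    modulo 2, although N is even. *)

(** * Families in (Z/4)^N with an alternating form *)

Lemma F2_cases (a : 'F_2) : a = 0 \/ a = 1.
Proof. by case: a => [[|[|[]]]] // lt; [left|right]; apply/val_inj. Qed.

Section CharTwo.
Variables (R : nzRingType) (R2 : 1 + 1 = 0 :> R).

Lemma char2_addrr (a : R) : a + a = 0.
Proof. by rewrite -[a]mulr1 -mulrDr R2 mulr0. Qed.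

Lemma char2_natr (m : nat) : m%:R = (odd m)%:R :> R.
Proof.
elim: m => // m IH; rewrite -natr1 IH /=.
by case: (odd m); rewrite ?add0r.
Qed.

(** The entries off the diagonal cancel in pairs. *)
Lemma char2_sum_sym m (f : 'I_m -> 'I_m -> R) :
  (forall i j, i != j -> f i j = f j i) -> \sum_i \sum_j f i j = \sum_i f i i.
Proof.
move=> fs.
have split3 i : \sum_j f i j =
    f i i + (\sum_(j < m) (if (i < j)%N then f i j else 0)
             + \sum_(j < m) (if (j < i)%N then f i j else 0)).
  rewrite -big_split (bigD1 i) //= [in RHS](bigD1 i) //= !ltnn addr0 add0r.
  congr (_ + _); apply: eq_bigr => j ne.
  by case: ltngtP ne => [_ _|_ _|/val_inj->]; rewrite ?addr0 ?add0r ?eqxx.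
under eq_bigr do rewrite split3.
rewrite big_split big_split /=.
rewrite [X in _ + (_ + X)](_ : _ =
    \sum_(i < m) \sum_(j < m) (if (i < j)%N then f i j else 0)).
  by rewrite char2_addrr addr0.
rewrite exchange_big; apply: eq_bigr => i _; apply: eq_bigr => j _.
by case: ifP => // lt; apply: fs; rewrite neq_ltn lt orbT.
Qed.

End CharTwo.

Lemma F2_char2 : 1 + 1 = 0 :> 'F_2. Proof. exact/val_inj. Qed.

Lemma intr_F2_eq0 (k : int) : (k%:~R == 0 :> 'F_2) = ((k %% 2)%Z == 0).
Proof.
have e : k%:~R = ((k %% 2)%Z)%:~R :> 'F_2.
  rewrite {1}(divz_eq k 2) rmorphD rmorphM /= (_ : 2%:~R = 0) ?mulr0 ?add0r //.
  exact/val_inj.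
rewrite e; have [->|->] : (k %% 2)%Z = 0 \/ (k %% 2)%Z = 1 by lia.
  by rewrite eqxx.
by rewrite oner_eq0.
Qed.

Section Form.
Variables (R : comNzRingType) (N : nat) (J : 'M[R]_N).

Definition mxform (u v : 'rV[R]_N) : R := (u *m J *m v^T) 0 0.

Lemma mxformDl u v w : mxform (u + v) w = mxform u w + mxform v w.
Proof. by rewrite /mxform !mulmxDl mxE. Qed.

Lemma mxformZl c u w : mxform (c *: u) w = c * mxform u w.
Proof. by rewrite /mxform -!scalemxAl mxE. Qed.

Lemma mxformDr u v w : mxform w (u + v) = mxform w u + mxform w v.
Proof. by rewrite /mxform linearD mulmxDr mxE. Qed.

Lemma mxformZr c u w : mxform w (c *: u) = c * mxform w u.
Proof. by rewrite /mxform linearZ -scalemxAr mxE. Qed.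

Lemma mxform_sumr (I : finType) (P : pred I) u (v : I -> 'rV[R]_N) :
  mxform u (\sum_(i | P i) v i) = \sum_(i | P i) mxform u (v i).
Proof. by rewrite /mxform linear_sum mulmx_sumr summxE. Qed.

Lemma mxform_antisym u v : J^T = - J -> mxform v u = - mxform u v.
Proof.
move=> Ja; have -> : mxform v u = (v *m J *m u^T)^T 0 0 by rewrite [RHS]mxE.
by rewrite !trmx_mul trmxK Ja mulmxA mulmxN mulNmx mxE.
Qed.

End Form.

Lemma mxform_map (R S : comNzRingType) (f : {rmorphism R -> S}) N (J : 'M_N) u v :
  mxform (map_mx f J) (map_mx f u) (map_mx f v) = f (mxform J u v).
Proof. by rewrite /mxform -map_mxM map_trmx -map_mxM mxE. Qed.

Section Gram.
Variables (R : fieldType) (R2 : 1 + 1 = 0 :> R) (N : nat) (J : 'M[R]_N).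

(** Over a field of characteristic 2, vectors with pairwise products 1 and
    squares 0 have Gram matrix U - 1, with U the all-one matrix, and
    (U - 1)^2 = m U - 2 U + 1 = 1 when their number m is even. *)
Lemma gram_even_inv m (c : 'I_m -> 'rV_N) (V := \matrix_i c i) :
  ~~ odd m -> (forall i j, mxform J (c i) (c j) = (i != j)%:R) ->
  (V *m J *m V^T) *m (V *m J *m V^T) = 1%:M.
Proof.
move=> m_even Hc; set G := _ *m _^T.
have GE : G = const_mx 1 - 1%:M.
  apply/matrixP=> i j; transitivity (mxform J (c i) (c j)).
    rewrite /mxform -(rowK c i) -(rowK c j) -/V tr_row -row_mul /G mxE [RHS]mxE.
    by apply: eq_bigr => k _; congr (_ * _); rewrite [RHS]mxE.
  rewrite Hc !mxE; case: eqVneq => _ /=; first by rewrite subrr.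
  by rewrite subr0.
have cc : (const_mx 1 : 'M[R]_m) *m (const_mx 1 : 'M[R]_m) = 0.
  apply/matrixP=> i j; rewrite !mxE.
  under eq_bigr do rewrite !mxE mulr1.
  by rewrite sumr_const card_ord (char2_natr R2) (negbTE m_even).
rewrite GE mulmxBl !mulmxBr cc mul1mx !mulmx1.
by apply/matrixP=> i j; rewrite !mxE -[RHS]subr0 -[in RHS]R2; ring.
Qed.

(** An invertible Gram matrix factors through the space of vectors. *)
Lemma gram_even_le m (c : 'I_m -> 'rV_N) :
  ~~ odd m -> (forall i j, mxform J (c i) (c j) = (i != j)%:R) -> (m <= N)%N.
Proof.
move=> m_even Hc; have := gram_even_inv m_even Hc; set V := \matrix_i c i => GG.
rewrite -[X in (X <= _)%N](mxrank1 R) -GG -!mulmxA.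
exact: leq_trans (mxrankM_maxl _ _) (rank_leq_col _).
Qed.

(** N of the N + 1 vectors form a basis, because their Gram matrix is
    invertible; the sum of all N + 1 pairs to N = 0 with each of them. *)
Lemma gram_sum_radical (c : 'I_N.+1 -> 'rV_N) : ~~ odd N ->
  (forall i j, mxform J (c i) (c j) = (i != j)%:R) ->
  forall u, mxform J u (\sum_i c i) = 0.
Proof.
move=> N_even Hc u.
pose c' (i : 'I_N) := c (lift ord0 i); pose V := \matrix_i c' i.
have Hc' i j : mxform J (c' i) (c' j) = (i != j)%:R.
  by rewrite Hc (inj_eq lift_inj).
have /= GG := gram_even_inv N_even Hc'; rewrite -/V in GG.
have Vu : V \in unitmx.
  have VW : V *m (J *m V^T *m (V *m J *m V^T)) = 1%:M.
    by rewrite -[RHS]GG !mulmxA.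
  by have [] := mulmx1_unit VW.
suff : V *m (J *m (\sum_i c i)^T) = 0.
  move/(congr1 (mulmx (invmx V))); rewrite mulKmx // mulmx0 => H.
  by rewrite /mxform -mulmxA H mulmx0 mxE.
apply/row_matrixP=> i; rewrite row_mul rowK row0 mulmxA.
apply/matrixP=> a b; rewrite !ord1 [RHS]mxE -/(mxform J _ _) mxform_sumr.
under eq_bigr do rewrite Hc.
rewrite (bigD1 (lift ord0 i)) //= eqxx add0r.
under eq_bigr => j ne do rewrite eq_sym ne.
have := cardC1 (lift ord0 i); rewrite card_ord /= => cN.
by rewrite sumr_const cN (char2_natr R2) (negbTE N_even).
Qed.

End Gram.

Section KummerFamily.

Variables (N : nat) (J : 'M[int]_N) (I : finType) (e : I -> 'rV[int]_N).

Local Notation w x y := (mxform J (e x) (e y)).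
Local Notation par x := (map_mx intr (e x) : 'rV['F_2]_N).

(** What the Kummer property imposes on exponent vectors whose monomials satisfy
    m_x m_y = i^(w x y) m_y m_x: the three clauses come from the words of type
    (3, 1), (2, 2) and (2, 1, 1) in the fourth power of a linear combination. *)
Definition kummer_family :=
  [/\ forall x y, x != y -> (w x y %% 4)%Z <> 0,
      forall x y, (w x y %% 4)%Z = 2 -> par x = par y
    & forall x y z, (w x y %% 4)%Z = 1 -> (w y z %% 4)%Z = 1 ->
        (w x z %% 4)%Z = 1 \/
        forall j, ((e x (0 : 'I_1) j + 2 * e y (0 : 'I_1) j
                    + e z (0 : 'I_1) j)%R %% 4)%Z = 0].

Hypotheses (Ja : J^T = - J) (N_even : ~~ odd N) (eP : kummer_family).

Let w_anti x y : w y x = - w x y. Proof. exact: mxform_antisym. Qed.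

Let par_eq x y : par x = par y -> exists d, e y = e x + 2 *: d.
Proof.
move=> /matrixP pxy; exists (\row_j ((e y (0 : 'I_1) j - e x (0 : 'I_1) j)%R %/ 2)%Z).
apply/rowP=> j; rewrite !mxE; have := pxy 0 j; rewrite !mxE => /esym/eqP.
by rewrite -subr_eq0 -rmorphB /= intr_F2_eq0; lia.
Qed.

Let w_shift x d y z : e y = e x + 2 *: d -> w y z = w x z + 2 * mxform J d (e z).
Proof. by move=> ->; rewrite mxformDl mxformZl. Qed.

Let w_same x y : x != y -> par x = par y -> (w x y %% 4)%Z = 2.
Proof.
move=> ne /par_eq [d /(w_shift x)]; have := w_anti x x; have := w_anti x y.
have [/(_ _ _ ne)] := eP; lia.
Qed.

Let w_diff x y : par x != par y -> (w x y %% 4)%Z = 1 \/ (w x y %% 4)%Z = 3.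
Proof.
move=> ne; have nxy : x != y by apply: contraNneq ne => ->.
have [/(_ _ _ nxy) H0 /(_ x y) H2 _] := eP.
suff : (w x y %% 4)%Z <> 2 by lia.
by move/H2=> E; rewrite E eqxx in ne.
Qed.

Let par2_gram x y : mxform (map_mx intr J) (par x) (par y) = (par x != par y)%:R.
Proof.
rewrite mxform_map; case: eqVneq => [E|/w_diff ne] /=.
  apply/eqP; rewrite intr_F2_eq0; have := w_anti x x; have := w_anti y y.
  have [d /(w_shift y)] := par_eq E; have := w_anti x y; lia.
have : (w x y)%:~R != 0 :> 'F_2 by rewrite intr_F2_eq0; lia.
by case: (F2_cases (w x y)%:~R) => ->; rewrite ?eqxx.
Qed.

(** If b = a + 2 d and c = a + 2 f anticommute with a, then the form is odd at
    (a, d) and at (a, f); w b c is twice the difference of these values modulo 4,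
    so that b and c commute. *)
Let class_card x : (#|[set y | par y == par x]| <= 2)%N.
Proof.
rewrite leqNgt; apply/negP=> /card_gt2P [a [b [c [[]]]]].
rewrite !inE => /eqP pa /eqP pb /eqP pc [nab nbc nca].
have [d ed] : exists d, e b = e a + 2 *: d by apply: par_eq; rewrite pa pb.
have [f ef] : exists f, e c = e a + 2 *: f by apply: par_eq; rewrite pa pc.
have := w_same nab (etrans pa (esym pb)); have := w_same nbc (etrans pb (esym pc)).
have := w_same nca (etrans pc (esym pa)).
have := w_shift c ed; have := w_shift a ef; have := w_shift a ed.
have : mxform J d (e c) = mxform J d (e a) + 2 * mxform J d f.
  by rewrite ef mxformDr mxformZr.
have := w_anti a b; have := w_anti b c; have := w_anti a c; have := w_anti a a.
lia.
Qed.

Let P := [set par x | x in I].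

Let P_card : (#|P| <= N.+1)%N.
Proof.
rewrite leqNgt; apply/negP=> lt.
pose c (i : 'I_N.+2) : 'rV['F_2]_N := enum_val (widen_ord lt i).
suff : (N.+2 <= N)%N by lia.
apply: (@gram_even_le _ F2_char2 _ (map_mx intr J) _ c); first by rewrite /= negbK.
move=> i j; have /imsetP[x _ cx] : c i \in P by apply: enum_valP.
have /imsetP[y _ cy] : c j \in P by apply: enum_valP.
rewrite cx cy par2_gram -cx -cy (inj_eq enum_val_inj).
by rewrite -val_eqE.
Qed.

Let cardI : #|I| = \sum_(p in P) #|[set y | par y == p]|.
Proof.
rewrite -sum1_card (partition_big (fun x => par x) (mem P)) /= => [|x _].
  by apply: eq_bigr => p _; rewrite -sum1_card; apply: eq_bigl => x; rewrite inE.
exact: imset_f.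
Qed.

Let fiber_card p : p \in P -> (#|[set y | par y == p]| <= 2)%N.
Proof. by case/imsetP=> x _ ->; apply: class_card. Qed.

(** Call class j a splitting class of the pair b_i, b'_i when its members lie on a
    path between b_i and b'_i; this is what f i j = 1 says for i <> j.  The
    crux is that splitting is symmetric: a third class k cannot split the pair
    i as well, so it lies entirely before or entirely after both b_i and b'_i,
    hence, by transitivity of paths, on the same side of both members of j;
    thus only i can split j, and zero row sums demand that some class does. *)
Lemma kummer_family_card : (#|I| <= 2 * N + 1)%N.
Proof.
rewrite leqNgt; apply/negP=> I_big.
have P_eq : #|P| = N.+1.
  apply/eqP; rewrite eqn_leq P_card /=.
  have le2 : (#|I| <= #|P| * 2)%N by rewrite cardI -sum_nat_const leq_sum.
  have := leq_trans I_big le2; move: #|P| => k; lia.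
have fiber2 p : p \in P -> (1 < #|[set y | par y == p]|)%N.
  move=> pP; rewrite ltnNge; apply/negP=> le1.
  have : (#|I| < #|P| * 2)%N.
    rewrite cardI -sum_nat_const (bigD1 p) //= [X in (_ < X)%N](bigD1 p) //=.
    rewrite -addSn leq_add //.
    by apply: leq_sum => q /andP[qP _]; apply: fiber_card.
  rewrite P_eq; move: I_big; move: #|I| => k; lia.
pose c (i : 'I_N.+1) := enum_val (cast_ord (esym P_eq) i).
have cP i : c i \in P by apply: enum_valP.
have cE i j : (c i == c j) = (i == j).
  by rewrite (inj_eq enum_val_inj) (inj_eq (@cast_ord_inj _ _ _)).
have /fin_all_exists [bb bbP] : forall i, exists xy : I * I,
    [/\ par xy.1 = c i, par xy.2 = c i & xy.1 != xy.2].
  move=> i; have /card_gt1P[x [y []]] := fiber2 _ (cP i).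
  by rewrite !inE => /eqP px /eqP py ne; exists (x, y).
pose b i := (bb i).1; pose b' i := (bb i).2.
have pb i : par (b i) = c i by case: (bbP i).
have pb' i : par (b' i) = c i by case: (bbP i).
have nb i : b i != b' i by case: (bbP i).
have {bbP} /fin_all_exists [d dP] : forall i, exists d : 'rV[int]_N,
    e (b' i) = e (b i) + 2 *: d.
  by move=> i; apply: par_eq; rewrite pb pb'.
have wbb i : (w (b i) (b' i) %% 4)%Z = 2 by apply: w_same; rewrite // pb pb'.
(* Only the class of b_j modulo 2 matters, so that either member of it computes
   f i j. *)
pose f i j := mxform (map_mx intr J) (map_mx intr (d i)) (c j).
have fE i j y : par y = c j -> f i j = (mxform J (d i) (e y))%:~R.
  by move=> py; rewrite /f -py mxform_map.
have f_diag i : f i i = 1.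
  suff : f i i != 0 by case: (F2_cases (f i i)) => ->; rewrite ?eqxx.
  rewrite (fE _ _ _ (pb i)) intr_F2_eq0.
  have := w_shift (b i) (dP i); have := wbb i; have := w_anti (b i) (b' i).
  have := w_anti (b i) (b i); lia.
have f_row i : \sum_j f i j = 0.
  rewrite -mxform_sumr; apply: (gram_sum_radical F2_char2) => // j k.
  by rewrite -(pb j) -(pb k) par2_gram !pb cE.
have w_odd i j y z : i != j -> par y = c i -> par z = c j ->
    (w y z %% 4)%Z = 1 \/ (w y z %% 4)%Z = 3.
  by move=> ne py pz; apply: w_diff; rewrite py pz cE.
have split1 i j y : i != j -> par y = c j -> f i j = 1 ->
    exists u u', [/\ (w u y %% 4)%Z = 1, (w y u' %% 4)%Z = 1 &
      (u = b i /\ u' = b' i) \/ (u = b' i /\ u' = b i)].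
  move=> ne py /eqP; rewrite (fE _ _ _ py) => f1.
  have : (mxform J (d i) (e y))%:~R != 0 :> 'F_2 by rewrite (eqP f1) oner_eq0.
  rewrite intr_F2_eq0 => {}f1.
  have := w_shift y (dP i); have := w_anti (b i) y; have := w_anti (b' i) y.
  have := w_odd i j _ _ ne (pb i) py; have := w_odd i j _ _ ne (pb' i) py.
  case=> h1; case=> h2 h3 h4 h5; try lia.
    by exists (b' i), (b i); split; [lia|lia|right].
  by exists (b i), (b' i); split; [lia|lia|left].
(* A path u, y, u' cannot be closed by w u u' = 1, because b_i and b'_i
   anticommute. *)
have mid i j y : i != j -> par y = c j -> f i j = 1 ->
    forall k, ((e (b i) 0 k + 2 * e y 0 k + e (b' i) 0 k)%R %% 4)%Z = 0.
  move=> ne py /(split1 _ _ _ ne py) [u [u' [uy yu' uu']]] k.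
  have [_ _ /(_ _ _ _ uy yu') []] := eP.
    by case: uu' => -[-> ->]; have := wbb i; have := w_anti (b i) (b' i); lia.
  by move/(_ k); case: uu' => -[-> ->]; lia.
(* Two splitting classes would give 2 b_j = - b_i - b'_i = 2 b_k modulo 4. *)
have f_uniq i j k : i != j -> i != k -> f i j = 1 -> f i k = 1 -> j = k.
  move=> nij nik fij fik; apply/eqP; rewrite -cE -(pb j) -(pb k); apply/eqP.
  apply/rowP=> l; rewrite !mxE; apply/eqP; rewrite -subr_eq0 -rmorphB /=.
  have := mid _ _ _ nij (pb j) fij l; have := mid _ _ _ nik (pb k) fik l.
  by rewrite intr_F2_eq0; lia.
have f_sym1 i j : i != j -> f i j = 1 -> f j i = 1.
  move=> nij fij; case: (F2_cases (f j i)) => // fji.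
  have [k /andP[njk /eqP fjk]] : exists k, (j != k) && (f j k == 1).
    apply/existsP; rewrite -[X in is_true X]negbK; apply/negP=> /existsPn H.
    have := f_row j; rewrite (bigD1 j) //= f_diag big1 => [|k nk].
      by move/eqP; rewrite addr0 oner_eq0.
    case: (F2_cases (f j k)) => // fjk.
    by have := H k; rewrite eq_sym nk fjk eqxx.
  have nik : i != k.
    apply/eqP=> E; move: fjk; rewrite -E fji => /eqP.
    by rewrite eq_sym oner_eq0.
  have fik : f i k = 0.
    case: (F2_cases (f i k)) => // fik.
    by have := f_uniq _ _ _ nij nik fij fik => E; rewrite E eqxx in njk.
  have same_z u : u = b i \/ u = b' i -> (w u (b k) %% 4)%Z = (w (b i) (b k) %% 4)%Z.
    case=> -> //; have := w_shift (b k) (dP i).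
    by move/eqP: fik; rewrite (fE _ _ _ (pb k)) intr_F2_eq0; clear; lia.
  (* Both members of class j are on the same side of b_k as the pair i. *)
  have same_y y : par y = c j -> (w y (b k) %% 4)%Z = (w (b i) (b k) %% 4)%Z.
    move=> py; have [u [u' [uy yu' uu']]] := split1 _ _ _ nij py fij.
    have := same_z u; have := same_z u'.
    have {}uu' : (u = b i \/ u = b' i) /\ (u' = b i \/ u' = b' i).
      by case: uu' => -[]; split; auto.
    have pu : par u = c i by case: uu' => -[->|->].
    have pu' : par u' = c i by case: uu' => _ [->|->].
    case: uu' => hu hu' /(_ hu') su' /(_ hu) su.
    have [_ _ H3] := eP.
    have trans z1 z2 z3 j1 j3 : par z1 = c j1 -> par z3 = c j3 -> j1 != j3 ->
       (w z1 z2 %% 4)%Z = 1 -> (w z2 z3 %% 4)%Z = 1 -> (w z1 z3 %% 4)%Z = 1.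
      move=> p1 p3 n13 h1 h2; case: (H3 _ _ _ h1 h2) => // h.
      case/negP: n13; rewrite -cE -p1 -p3; apply/eqP/rowP=> l; rewrite !mxE.
      apply/eqP; rewrite -subr_eq0 -rmorphB /= intr_F2_eq0.
      by move: (h l); clear; lia.
    case: (w_odd i k (b i) (b k) nik (pb i) (pb k)) => wik.
      rewrite wik in su su' *.
      exact: trans py (pb k) njk yu' su'.
    have wku : (w (b k) u %% 4)%Z = 1 by move: (w_anti (b k) u) su wik; clear; lia.
    have := trans _ _ _ _ _ (pb k) py _ wku uy; rewrite eq_sym => /(_ njk).
    by move: (w_anti (b k) y) wik; clear; lia.
  have : (mxform J (d j) (e (b k)))%:~R != 0 :> 'F_2.
    by rewrite -(fE _ _ _ (pb k)) fjk oner_eq0.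
  move: (w_shift (b k) (dP j)) (same_y _ (pb j)) (same_y _ (pb' j)).
  by rewrite intr_F2_eq0; clear; lia.
have f_sym i j : i != j -> f i j = f j i.
  move=> nij; case: (F2_cases (f i j)) => fij.
    case: (F2_cases (f j i)) => fji; first by rewrite fij fji.
    by rewrite fji (f_sym1 j i) // eq_sym.
  by rewrite fij f_sym1.
have := char2_sum_sym F2_char2 f_sym.
under eq_bigr do rewrite f_row; under [in RHS]eq_bigr do rewrite f_diag.
rewrite big1 // sumr_const card_ord (char2_natr F2_char2) /= N_even => /eqP.
by rewrite eq_sym oner_eq0.
Qed.

End KummerFamily.

(** * Polarization of the fourth power through Jordan products *)

Lemma primitive4_sqr (F : fieldType) (z : F) : 4.-primitive_root z -> z ^+ 2 = -1.
Proof.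
move=> zP; have /eqP := prim_expr_order zP; rewrite -[4%N]/(2 * 2)%N exprM -subr_eq0.
rewrite subr_sqr_1 mulf_eq0 => /orP[|]; last by rewrite addr_eq0 => /eqP.
by rewrite subr_eq0 => z2; have := prim_order_dvd zP 2; rewrite z2.
Qed.

Section Jordan.

Variables (F : fieldType) (A : falgType F).
Implicit Types (x y z : A) (t : F).

Definition jord x y := x * y + y * x.

Lemma jordC x y : jord x y = jord y x. Proof. exact: addrC. Qed.

Lemma jordDl x y z : jord (x + y) z = jord x z + jord y z.
Proof. by rewrite /jord mulrDl mulrDr addrACA. Qed.

Lemma jordDr x y z : jord x (y + z) = jord x y + jord x z.
Proof. by rewrite jordC jordDl !(jordC _ x). Qed.

Lemma jordZl t x y : jord (t *: x) y = t *: jord x y.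
Proof. by rewrite /jord -scalerAl -scalerAr scalerDr. Qed.

Lemma jordZr t x y : jord x (t *: y) = t *: jord x y.
Proof. by rewrite jordC jordZl jordC. Qed.

Lemma sqr_jord x y : (x + y) ^+ 2 = x ^+ 2 + jord x y + y ^+ 2.
Proof. by rewrite expr2 mulrDl !mulrDr /jord !addrA. Qed.

(** The components of the fourth power of a linear combination: jord31 is the sum
    of the 4 words in x, x, x, y; jord22 of the 6 words in x, x, y, y; jord211
    of the 12 words in x, x, y, z.  The Jordan form makes them polynomial
    expressions in a commutative bilinear product, since v^4 = (v^2)^2. *)
Definition jord31 x y := jord (x ^+ 2) (jord x y).
Definition jord22 x y := jord (x ^+ 2) (y ^+ 2) + jord x y ^+ 2.
Definition jord211 x y z := jord (x ^+ 2) (jord y z) + jord (jord x y) (jord x z).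

Lemma expr4_jord x y t : (x + t *: y) ^+ 4 =
  x ^+ 4 + t *: jord31 x y + t ^+ 2 *: jord22 x y + t ^+ 3 *: jord31 y x
    + t ^+ 4 *: y ^+ 4.
Proof.
rewrite -[4%N]/(2 * 2)%N !exprM sqr_jord exprZn jordZr.
set u := x ^+ 2; set v := jord x y; set w := y ^+ 2.
rewrite sqr_jord sqr_jord !jordDl !jordZl !jordZr !exprZn /jord31 /jord22.
rewrite -/u -/v -/w (jordC y x) -/v (jordC w v) !scalerA.
rewrite [in RHS](scalerDr _ (jord u w)) -exprS -!addrA; congr (_ + (_ + _)).
by rewrite addrCA.
Qed.

Lemma jord31_jord x y z t : jord31 (x + t *: z) y =
  jord31 x y + t *: jord211 x y z + t ^+ 2 *: jord211 z y x + t ^+ 3 *: jord31 z y.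
Proof.
rewrite /jord31 /jord211 sqr_jord exprZn jordZr jordDl jordZl.
rewrite (jordC y x) (jordC z x) (jordC y z).
move: (x ^+ 2) (z ^+ 2) (jord x z) (jord x y) (jord z y) => u w a b d.
rewrite !jordDl !jordZl !jordDr !jordZr (jordC b a) (jordC d a).
move: (jord u b) (jord u d) (jord a b) (jord a d) (jord w b) (jord w d).
move=> g1 g2 g3 g4 g5 g6; rewrite !scalerDr !scalerA -exprSr -expr2 !addrA.
by rewrite -[in LHS](addrAC _ (t ^+ 2 *: g5)).
Qed.

Section Polarization.

(** The functional phi stands for a coordinate that vanishes on F; it turns
    membership in F into scalar equations. *)
Variables (phi : {scalar A}) (V : {vspace A}).
Hypotheses (F_char0 : [pchar F] =i pred0) (phiV : forall v, v \in V -> phi (v ^+ 4) = 0).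

Let char0_natr_neq0 n : (0 < n)%N -> n%:R != 0 :> F.
Proof. by move/pcharf0P: F_char0 => ->; rewrite lt0n. Qed.

Lemma polar_odd (p q : F) : p + q = 0 -> 2%:R * p + 8%:R * q = 0 -> p = 0.
Proof.
move=> e1 e2; apply: (mulfI (@char0_natr_neq0 6 isT)).
by rewrite mulr0; transitivity (8%:R * (p + q) - (2%:R * p + 8%:R * q));
  [ring|rewrite e1 e2 mulr0 subr0].
Qed.

Lemma kummer_expansion x y t : x \in V -> y \in V ->
  t * phi (jord31 x y) + t ^+ 2 * phi (jord22 x y) + t ^+ 3 * phi (jord31 y x) = 0.
Proof.
move=> xV yV; have /phiV : x + t *: y \in V by rewrite memvD ?memvZ.
rewrite expr4_jord !linearD !linearZ /= (phiV xV) (phiV yV) => <-; ring.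
Qed.

Lemma kummer_jord22 x y : x \in V -> y \in V -> phi (jord22 x y) = 0.
Proof.
move=> xV yV; apply: (mulfI (@char0_natr_neq0 2 isT)); rewrite mulr0.
have := kummer_expansion (-1) xV yV; have := kummer_expansion 1 xV yV.
set p := phi _; set q := phi _; set r := phi _ => e1 e2.
by rewrite -[RHS](addr0 0) -[in X in X + _]e1 -[X in _ + X]e2; ring.
Qed.

Lemma kummer_jord31 x y : x \in V -> y \in V -> phi (jord31 x y) = 0.
Proof.
move=> xV yV; apply: (@polar_odd _ (phi (jord31 y x))).
  have := kummer_expansion 1 xV yV; rewrite (kummer_jord22 xV yV) => <-; ring.
have := kummer_expansion 2%:R xV yV; rewrite (kummer_jord22 xV yV) => <-; ring.
Qed.

Lemma kummer_jord211 x y z : x \in V -> y \in V -> z \in V ->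
  phi (jord211 x y z) = 0.
Proof.
move=> xV yV zV.
have H t : t * phi (jord211 x y z) + t ^+ 2 * phi (jord211 z y x) = 0.
  have /kummer_jord31 - /(_ _ yV) : x + t *: z \in V by rewrite memvD ?memvZ.
  rewrite jord31_jord; move: (kummer_jord31 xV yV) (kummer_jord31 zV yV).
  move: (jord31 x y) (jord31 z y) (jord211 x y z) (jord211 z y x) => p q r s.
  by move=> p0 q0; rewrite !linearD !linearZ /= p0 q0 => <-; ring.
apply: (mulfI (@char0_natr_neq0 2 isT)); rewrite mulr0.
have := H (-1); have := H 1; set p := phi _; set q := phi _ => e1 e2.
by rewrite -[RHS](subr0 0) -[X in X - _]e1 -[X in _ - X]e2; ring.
Qed.

End Polarization.

Section QuasiCommuting.

(** The next three values are those of the components on monomials: nonzero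
    multiples of a monomial in characteristic 0, except that the scalar in
    jord211_quasi vanishes when c = z. *)
Lemma jord31_comm x y : x * y = y * x -> jord31 x y = 4%:R *: (x * x * x * y).
Proof.
move=> xy; have yxA w : w * y * x = w * x * y by rewrite -mulrA -xy mulrA.
rewrite /jord31 /jord expr2 !(mulrDl, mulrDr) !mulrA -!xy !yxA.
by rewrite scaler_nat -!mulr2n -mulrnA.
Qed.

Lemma jord22_anti x y : x * y = - (y * x) -> jord22 x y = 2%:R *: (x * x * y * y).
Proof.
move=> xy; have yx : y * x = - (x * y) by rewrite xy opprK.
have yxA w : w * y * x = - (w * x * y) by rewrite -mulrA yx mulrN mulrA.
rewrite /jord22 {2}/jord yx addrN expr0n addr0 /jord !expr2 !mulrA.
by rewrite yxA yx !(mulNr, yxA, opprK) scaler_nat.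
Qed.

Lemma jord211_quasi (z c : F) m l r : z ^+ 2 = -1 ->
    l * m = z *: (m * l) -> m * r = z *: (r * m) -> l * r = c *: (r * l) ->
  jord211 m l r = (2%:R * ((1 + z) * c + (1 - z))) *: (m * m * r * l).
Proof.
move=> z2 lm mr lr.
have rm : r * m = - z *: (m * r).
  by rewrite mr scalerA mulNr -expr2 z2 opprK scale1r.
have lmA x : x * l * m = z *: (x * m * l) by rewrite -mulrA lm -scalerAr mulrA.
have rmA x : x * r * m = - z *: (x * m * r) by rewrite -mulrA rm -scalerAr mulrA.
have lrA x : x * l * r = c *: (x * r * l) by rewrite -mulrA lr -scalerAr mulrA.
rewrite /jord211 /jord expr2 !(mulrDl, mulrDr) !mulrA.
rewrite !(lm, rm, lr, lmA, rmA, lrA, =^~ scalerAl, scalerA) -!scalerDl.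
set w := m * m * r * l.
rewrite -[X in _ *: _ + X + _]scale1r -!scalerDl; congr (_ *: _); ring: z2.
Qed.

End QuasiCommuting.
End Jordan.

(** The q-binomial coefficients (4 choose k), 0 < k < 4, vanish at a primitive
    fourth root of unity. *)
Lemma expr4_quasi (F : fieldType) (A : falgType F) (z : F) (p q : A) :
  z ^+ 2 = -1 -> q * p = z *: (p * q) -> (p + q) ^+ 4 = p ^+ 4 + q ^+ 4.
Proof.
move=> z2 qp; have qpA x : x * q * p = z *: (x * p * q).
  by rewrite -mulrA qp -scalerAr mulrA.
rewrite -{1}[q]scale1r expr4_jord !expr1n !scale1r.
have -> : jord31 p q = 0.
  rewrite /jord31 /jord expr2 !(mulrDl, mulrDr) !mulrA.
  rewrite !(qp, qpA, =^~ scalerAl, scalerA) -!scalerDl.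
  rewrite -[X in X + _ + _]scale1r -!scalerDl -[RHS](scale0r (p * p * p * q)).
  by congr (_ *: _); ring: z2.
have -> : jord31 q p = 0.
  rewrite /jord31 /jord expr2 !(mulrDl, mulrDr) !mulrA.
  rewrite !(qp, qpA, =^~ scalerAl, scalerA) -!scalerDl.
  rewrite -[X in _ + (_ + X)]scale1r -!scalerDl -[RHS](scale0r (p * q * q * q)).
  by congr (_ *: _); ring: z2.
have -> : jord22 p q = 0.
  rewrite /jord22 /jord !expr2 !(mulrDl, mulrDr) !mulrA.
  rewrite !(qp, qpA, =^~ scalerAl, scalerA) -!scalerDl.
  rewrite -[X in X + _ + _]scale1r -!scalerDl -[RHS](scale0r (p * p * q * q)).
  by congr (_ *: _); ring: z2.
by rewrite !addr0.
Qed.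

(** * The monomial basis of a tensor product of symbol algebras *)

Section SymbolProduct.

Variables (F : fieldType) (z : F) (zP : 4.-primitive_root z).

(** The number of factors is decoupled from the base field, so that one can peel
    off factors while F stays fixed. *)
Definition symbol_prod n (a b : 'I_n -> F) : falgType F :=
  tensor_prod (fun j => symbol_alg zP (a j) (b j)).

Local Notation tl f := (fun j => f (lift ord0 j)).

(** The monomial with exponents k j, l j of the generators of the j-th factor;
    arbitrary exponents are allowed so that products stay monomials. *)
Fixpoint tmon n : forall (a b : 'I_n -> F) (k l : 'I_n -> nat), symbol_prod a b :=
  match n return forall (a b : 'I_n -> F) (k l : 'I_n -> nat), symbol_prod a b with
  | 0 => fun _ _ _ _ => (1 : F^o)
  | n'.+1 => fun a b k l =>
      tens (symbol_mon zP (a ord0) (b ord0) (k ord0) (l ord0))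
           (tmon (tl a) (tl b) (tl k) (tl l))
  end.

(** The coordinate along the monomial with exponents k, l. *)
Fixpoint tcoef n :
    forall (a b : 'I_n -> F) (k l : 'I_n -> 'I_4), symbol_prod a b -> F :=
  match n return
    forall (a b : 'I_n -> F) (k l : 'I_n -> 'I_4), symbol_prod a b -> F with
  | 0 => fun _ _ _ _ t => t
  | n'.+1 => fun a b k l t =>
      @tens_lift F (symbol_alg zP (a ord0) (b ord0)) (symbol_prod (tl a) (tl b)) F^o
        (fun u v => (u : 'M[F]_4) (k ord0) (l ord0) * tcoef (tl k) (tl l) v) t
  end.

Lemma eq_tmon n (a b : 'I_n -> F) k l k' l' :
  k =1 k' -> l =1 l' -> tmon a b k l = tmon a b k' l'.
Proof.
elim: n a b k l k' l' => //= n IH a b k l k' l' ek el.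
by rewrite ek el; congr (tens _ _); apply: IH => j.
Qed.

Lemma tens_linearl (A B : falgType F) (v : B) : linear (fun u : A => tens u v).
Proof. exact: (tens_bilin A B).1. Qed.
Lemma tens_linearr (A B : falgType F) (u : A) : linear (@tens F A B u).
Proof. exact: (tens_bilin A B).2. Qed.

Lemma tensZl (A B : falgType F) c (u : A) (v : B) : tens (c *: u) v = c *: tens u v.
Proof. exact: (GRing.semilinear_linear (tens_linearl v)).1. Qed.
Lemma tensZr (A B : falgType F) c (u : A) (v : B) : tens u (c *: v) = c *: tens u v.
Proof. exact: (GRing.semilinear_linear (tens_linearr u)).1. Qed.

Lemma tmonM n (a b : 'I_n -> F) k l k' l' :
  tmon a b k l * tmon a b k' l' =
  z ^- (\sum_j l j * k' j)%N *:
    tmon a b (fun j => k j + k' j)%N (fun j => l j + l' j)%N.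
Proof.
elim: n a b k l k' l' => [|n IH] a b k l k' l'.
  by rewrite big_ord0 expr0 invr1 scale1r /= mulr1.
rewrite /= [LHS]tensM IH symbol_monM tensZl tensZr scalerA.
by rewrite big_ord_recl /= exprD invfM.
Qed.

Lemma tmon_period n (a b : 'I_n -> F) p q k l :
  tmon a b (fun j => p j * 4 + k j)%N (fun j => q j * 4 + l j)%N =
  (\prod_j (a j ^+ p j * b j ^+ q j)) *: tmon a b k l.
Proof.
elim: n a b p q k l => [|n IH] a b p q k l /=.
  by rewrite big_ord0 scale1r.
rewrite IH symbol_monDl symbol_monDr scalerA tensZl tensZr scalerA.
by rewrite big_ord_recl /=.
Qed.

Lemma tmon1 n (a b : 'I_n -> F) : tmon a b (fun=> 0%N) (fun=> 0%N) = 1.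
Proof. by elim: n a b => //= n IH a b; rewrite IH. Qed.

Lemma tmon_ind n (a b : 'I_n -> F) (P : symbol_prod a b -> Prop) :
  (forall c u v, P u -> P v -> P (c *: u + v)) ->
  (forall k l, P (tmon a b k l)) -> forall t, P t.
Proof.
elim: n a b P => [|n IH] a b P Plin Pmon t.
  have P1 := Pmon (fun=> 0%N) (fun=> 0%N).
  have := Plin (-1) _ _ P1 P1; rewrite scaleN1r addNr => P0.
  by have := Plin t _ _ P1 P0; rewrite addr0 /= [_ *: _]mulr1.
move: t; apply: tens_ind => // u v.
move: u; apply: symbol_mon_ind => [c u u' Pu Pu'|k l].
  by rewrite tens_linearl; apply: Plin.
apply: (IH (tl a) (tl b) (fun v => P (tens _ v))) => [c v1 v2 P1 P2|k' l'].
  by rewrite tens_linearr; apply: Plin.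
pose cons (x : nat) (f : 'I_n -> nat) (j : 'I_n.+1) := oapp f x (unlift ord0 j).
have := Pmon (cons k k') (cons l l'); rewrite /= /cons unlift_none /=.
rewrite (@eq_tmon _ _ _ _ _ k' l') // => j; by rewrite liftK.
Qed.

Lemma tcoef_linear n (a b : 'I_n -> F) k l :
  linear (@tcoef n a b k l : _ -> F^o).
Proof. by case: n a b k l => [|n] a b k l c u v //; apply: tens_lift_linear. Qed.

Lemma tcoef_tens n (a b : 'I_n.+1 -> F) k l u v :
  tcoef k l (tens u v : symbol_prod a b) =
  (u : 'M[F]_4) (k ord0) (l ord0) * tcoef (tl k) (tl l) v.
Proof.
rewrite /= tens_liftE //; split=> [w|w] c x y.
  by rewrite !mxE mulrDl -mulrA.
by rewrite (tcoef_linear _ _ c) mulrDr; congr (_ + _); rewrite mulrCA.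
Qed.

Lemma tcoef_tmon n (a b : 'I_n -> F) (k l k' l' : 'I_n -> 'I_4) :
  tcoef k l (tmon a b k' l') =
  ([forall j, k' j == k j] && [forall j, l' j == l j])%:R.
Proof.
elim: n a b k l k' l' => [|n IH] a b k l k' l'.
  by rewrite /=; do 2!(case: forallP => [_|[]] /=; last by case).
rewrite [tmon _ _ _ _]/= tcoef_tens IH symbol_monE !mxE.
have E (f g : 'I_n.+1 -> 'I_4) : [forall j, f j == g j] =
    (f ord0 == g ord0) && [forall j : 'I_n, tl f j == tl g j].
  apply/forallP/andP => [H|[H0 /forallP H] j]; first by split=> //; apply/forallP.
  by case: (unliftP ord0 j) => [j' ->|->].
by rewrite !E -natrM mulnb andbACA (eq_sym (k ord0)) (eq_sym (l ord0)).
Qed.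

End SymbolProduct.

(** * Exponents modulo 4 and denominators *)

Section Residues.

Variable N : nat.
Implicit Types (m : 'X_{1..N}) (e : {ffun 'I_N -> 'I_4}).

Definition mquo m : 'X_{1..N} := [multinom (m i %/ 4)%N | i < N].
Definition mres m : {ffun 'I_N -> 'I_4} := [ffun i => inord (m i %% 4)].
(** Euclidean division by 4 splits an exponent into a monomial of the base field
    and a member of the monomial basis over that field. *)
Definition mexp (q : 'X_{1..N}) e : 'X_{1..N} := [multinom (q i * 4 + e i)%N | i < N].

Lemma mresE m i : mres m i = (m i %% 4)%N :> nat.
Proof. by rewrite ffunE inordK // ltn_mod. Qed.

Lemma mexp_quo_res m : mexp (mquo m) (mres m) = m.
Proof. by apply/mnmP=> i; rewrite !mnmE mresE -divn_eq. Qed.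

Lemma mquo_mexp q e : mquo (mexp q e) = q.
Proof. by apply/mnmP=> i; rewrite !mnmE divnMDl // divn_small ?addn0. Qed.

Lemma mres_mexp q e : mres (mexp q e) = e.
Proof.
by apply/ffunP=> i; apply/val_inj; rewrite /= mresE mnmE modnMDl modn_small.
Qed.

Lemma le_mexp q q' e : ((mexp q e <= mexp q' e) = (q <= q'))%O.
Proof.
have mexpE p : mexp p e = (p + (p + (p + p)) + [multinom (e i : nat) | i < N])%MM.
  by apply/mnmP=> i; rewrite !(mnmE, mnmDE); lia.
have lt_mexp p p' : (p < p' -> mexp p e < mexp p' e)%O.
  by move=> lt; rewrite !mexpE ltmc_add2l !ltm_add.
case: (leP q q') => [|/lt_mexp]; last by rewrite ltNge => /negbTE.
by rewrite le_eqVlt => /predU1P[->|/lt_mexp/ltW//]; rewrite lexx.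
Qed.

End Residues.

Lemma fraction_clear (R : idomainType) (f : {fraction R}) :
  exists2 d : R, d != 0 & exists p, tofrac d * f = tofrac p.
Proof.
exists (frac (repr f)).2; first exact: denom_ratioP.
exists (frac (repr f)).1; rewrite -[X in _ * X](reprK f).
unlock tofrac; rewrite -[_ * _]/(FracField.mul _ _) -FracField.pi_mul.
apply/eqmodP; rewrite /= FracField.equivfE /FracField.mulf.
by rewrite !numden_Ratio ?oner_eq0 ?mulf_neq0 ?denom_ratioP ?oner_eq0 //; apply/eqP; ring.
Qed.

(** * Monomials of the generic algebra *)

Section GenericMonomials.

Variables (K : fieldType) (n : nat) (i : K) (iP : 4.-primitive_root i).
Local Notation F := (generic_field K n).
Local Notation A := (generic_alg n iP).
Local Notation X := 'X_{1..n + n}.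
Local Notation E := {ffun 'I_(n + n) -> 'I_4}.

Definition gconst : {rmorphism K -> F} := (@tofrac _ \o @mpolyC (n + n) K).

(** The generators of the k-th factor are indexed like alpha_k and beta_k, their
    fourth powers; gmon_mexp is the reason for this choice. *)
Definition gmon (m : X) : A :=
  tmon (generic_prim_root n iP) (@generic_alpha K n) (@generic_beta K n)
    (fun j => m (lshift n j)) (fun j => m (rshift n j)).

Definition gcoef (e : E) (v : A) : F :=
  @tcoef _ _ (generic_prim_root n iP) n (@generic_alpha K n) (@generic_beta K n)
    (fun j => e (lshift n j)) (fun j => e (rshift n j)) v.

(** The exponent of i^-1 needed to sort the product of two monomials. *)
Definition gpair (m m' : X) : nat := \sum_j m (rshift n j) * m' (lshift n j).

Lemma gmonM m m' : gmon m * gmon m' = gconst i ^- gpair m m' *: gmon (m + m')%MM.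
Proof.
rewrite /gmon [LHS]tmonM; congr (_ *: _).
by apply: eq_tmon => j; rewrite mnmDE.
Qed.

Lemma gmon0 : gmon 0%MM = 1.
Proof.
by rewrite -[RHS](tmon1 (generic_prim_root n iP)); apply: eq_tmon => j; rewrite mnmE.
Qed.

Lemma gmon_mexp (q : X) (e : E) :
  gmon (mexp q e) = tofrac 'X_[q] *: gmon (mexp 0%MM e).
Proof.
transitivity (\prod_j (@generic_alpha K n j ^+ q (lshift n j) *
    @generic_beta K n j ^+ q (rshift n j)) *: gmon (mexp 0%MM e)).
  rewrite /gmon -[RHS]tmon_period.
  by apply: eq_tmon => j; rewrite !mnmE.
congr (_ *: _); rewrite mpolyXE_id rmorph_prod big_split_ord /= -big_split /=.
by apply: eq_bigr => j _; rewrite !rmorphXn.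
Qed.

Lemma gcoef_linear e : linear_for *%R (gcoef e).
Proof. exact: tcoef_linear. Qed.

HB.instance Definition _ e := GRing.isLinear.Build F A F *%R (gcoef e) (gcoef_linear e).

Lemma gcoef_mexp0 e e' : gcoef e (gmon (mexp 0%MM e')) = (e' == e)%:R.
Proof.
rewrite /gcoef /gmon.
rewrite (@eq_tmon _ _ _ _ _ _ _ _ (fun j => e' (lshift n j))
  (fun j => e' (rshift n j))); last 2 first.
- by move=> j; rewrite !mnmE.
- by move=> j; rewrite !mnmE.
rewrite tcoef_tmon; congr (nat_of_bool _)%:R.
apply/andP/eqP => [[/forallP el /forallP er]|->]; last by split; apply/forallP.
apply/ffunP=> k; rewrite -(splitK k); case: (split k) => j /=.
  exact/eqP/el.
exact/eqP/er.
Qed.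

Lemma gcoef_mon e m :
  gcoef e (gmon m) = (mres m == e)%:R * tofrac 'X_[mquo m].
Proof.
by rewrite -{1}(mexp_quo_res m) gmon_mexp linearZ /= gcoef_mexp0 mulrC.
Qed.

Lemma gmon_ind (P : A -> Prop) :
  (forall c u v, P u -> P v -> P (c *: u + v)) -> (forall m, P (gmon m)) ->
  forall v, P v.
Proof.
move=> Plin Pmon; apply: tmon_ind => // k l.
pose m : X :=
  [multinom match split j with inl a => k a | inr a => l a end | j < n + n].
have := Pmon m; rewrite /gmon.
rewrite (@eq_tmon _ _ _ _ _ _ _ _ k l) // => j; rewrite mnmE.
  by rewrite (unsplitK (inl _)).
by rewrite (unsplitK (inr _)).
Qed.

Lemma gexpand v : v = \sum_e gcoef e v *: gmon (mexp 0%MM e).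
Proof.
move: v; apply: gmon_ind => [c u v Eu Ev|m].
  rewrite {1}Eu {1}Ev scaler_sumr -big_split; apply: eq_bigr => e _ /=.
  by rewrite linearP /= scalerDl scalerA.
rewrite (bigD1 (mres m)) //= gcoef_mon eqxx mul1r -gmon_mexp mexp_quo_res.
rewrite big1 ?addr0 // => e ne; rewrite gcoef_mon eq_sym (negbTE ne).
by rewrite mul0r scale0r.
Qed.

End GenericMonomials.

(** * Leading monomials *)

Section LeadingTerms.

Variables (K : fieldType) (n : nat) (i : K) (iP : 4.-primitive_root i).
Local Notation F := (generic_field K n).
Local Notation A := (generic_alg n iP).
Local Notation X := 'X_{1..n + n}.
Local Notation E := {ffun 'I_(n + n) -> 'I_4}.
Local Notation gconst := (gconst K n).
Local Notation gmon := (@gmon _ n _ iP).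

(** Elements without denominators are K-combinations of monomials; mspan P is the
    K-span of those whose exponents satisfy P. *)
Inductive mspan (P : X -> Prop) : A -> Prop :=
| mspan0 : mspan P 0
| mspanS c m v : P m -> mspan P v -> mspan P (gconst c *: gmon m + v).

Lemma mspanD P u v : mspan P u -> mspan P v -> mspan P (u + v).
Proof.
move=> Pu Pv; elim: Pu => [|c m w Pm _ IH]; first by rewrite add0r.
by rewrite -addrA; constructor.
Qed.

Lemma mspan_sum (I : Type) (r : seq I) (Q : pred I) (f : I -> A) P :
  (forall j, Q j -> mspan P (f j)) -> mspan P (\sum_(j <- r | Q j) f j).
Proof.
by move=> Pf; elim/big_ind: _ => //; [constructor | move=> *; apply: mspanD].
Qed.

Lemma mspan_gmon P c m : P m -> mspan P (gconst c *: gmon m).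
Proof. by move=> Pm; rewrite -[_ *: _]addr0; constructor => //; constructor. Qed.

Lemma gconst_gmonM c m c' m' : gconst c *: gmon m * (gconst c' *: gmon m') =
  gconst (c * c' * i ^- gpair m m') *: gmon (m + m')%MM.
Proof.
rewrite -scalerAl -scalerAr gmonM !scalerA !rmorphM fmorphV rmorphXn.
by [].
Qed.

Lemma mspanM (P Q R : X -> Prop) u v :
  (forall m m', P m -> Q m' -> R (m + m')%MM) ->
  mspan P u -> mspan Q v -> mspan R (u * v).
Proof.
move=> PQR Pu Qv; elim: Pu => [|c m w Pm _ IH]; first by rewrite mul0r; constructor.
rewrite mulrDl; apply: mspanD => //.
elim: Qv => [|c' m' w' Qm' _ IH']; first by rewrite mulr0; constructor.
by rewrite mulrDr gconst_gmonM; constructor; [apply: PQR|].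
Qed.

(** The leading part t is an element of the algebra rather than a coefficient, so
    that has_topM involves no power of i, and t = 0 is allowed, so that has_topD needs
    no absence of cancellation. *)
Definition has_top (M : X) (t v : A) : Prop :=
  (exists c, t = gconst c *: gmon M) /\ mspan (fun m => (m < M)%O) (v - t).

Lemma has_topD M t t' v v' :
  has_top M t v -> has_top M t' v' -> has_top M (t + t') (v + v').
Proof.
move=> [[c ->] Lv] [[c' ->] Lv']; split.
  by exists (c + c'); rewrite rmorphD scalerDl.
by rewrite opprD addrACA; apply: mspanD.
Qed.

Lemma has_topM M M' t t' v v' :
  has_top M t v -> has_top M' t' v' -> has_top (M + M')%MM (t * t') (v * v').
Proof.
move=> [[c ->] Lv] [[c' ->] Lv']; split.
  by rewrite gconst_gmonM; eexists.
rewrite -{1}(subrK (gconst c *: gmon M) v) -{1}(subrK (gconst c' *: gmon M') v').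
move: (v - _) (v' - _) Lv Lv' => r r' Lv Lv'.
rewrite mulrDl !mulrDr addrA addrK -addrA; apply: mspanD.
  by apply: (mspanM _ Lv Lv') => m m'; apply: ltm_add.
apply: mspanD.
  apply: (mspanM (Q := fun m => m = M') _ Lv); last exact: mspan_gmon.
  by move=> m m' lt ->; rewrite ltmc_add2l.
apply: (mspanM (P := fun m => m = M) _ _ Lv'); last exact: mspan_gmon.
by move=> m m' -> lt; rewrite ltmc_add2r.
Qed.

Lemma has_top_eq M M' t v : M = M' -> has_top M t v -> has_top M' t v.
Proof. by move=> ->. Qed.

(** The coordinate at the residue of M is a polynomial in which only the exponent
    M itself contributes the monomial of exponent mquo M. *)
Lemma gcoef_lower M v : mspan (fun m => (m < M)%O) v ->
  exists2 p : {mpoly K[n + n]}, gcoef (mres M) v = tofrac p & p@_(mquo M) = 0.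
Proof.
elim=> [|c m w lt _ [p pE p0]]; first by exists 0; rewrite ?linear0 ?mcoeff0.
have [eq|ne] := eqVneq (mres m) (mres M); last first.
  exists p => //; rewrite linearP /= gcoef_mon (negbTE ne) mul0r.
  by rewrite mulr0 add0r.
exists (c%:MP * 'X_[mquo m] + p).
  by rewrite linearP /= gcoef_mon eq eqxx mul1r pE rmorphD rmorphM.
rewrite mcoeffD p0 mcoeffCM mcoeffX; case: eqVneq => [eq'|_].
  by move: lt; rewrite -(mexp_quo_res m) eq eq' mexp_quo_res ltxx.
by rewrite mulr0 addr0.
Qed.

Lemma has_top_coef_eq0 M t v : has_top M t v -> gcoef (mres M) v = 0 -> t = 0.
Proof.
move=> [[c ->] /gcoef_lower [p pE p0]].
rewrite linearB /= linearZ /= gcoef_mon eqxx mul1r in pE.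
move=> v0; suff -> : c = 0 by rewrite rmorph0 scale0r.
have /eqP : tofrac (c%:MP * 'X_[mquo M] + p) = 0 :> F.
  by rewrite tofracD tofracM -[X in _ + X]pE v0 sub0r addrN.
rewrite tofrac_eq0 => /eqP/(congr1 (mcoeff (mquo M))).
by rewrite mcoeffD p0 mcoeffCM mcoeffX eqxx mulr1 addr0 mcoeff0.
Qed.

Lemma gmon_neq0 m : gmon m != 0.
Proof.
apply/eqP=> m0; have := gcoef_mon iP (mres m) m; rewrite m0 linear0 eqxx mul1r.
move=> /esym/eqP; rewrite tofrac_eq0 => /eqP/(congr1 (mcoeff (mquo m))).
by rewrite mcoeffX eqxx mcoeff0 => /eqP; rewrite oner_eq0.
Qed.

Lemma clear_denominators (v : A) : exists2 D : F, D != 0 &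
  exists p : E -> {mpoly K[n + n]}, forall e, D * gcoef e v = tofrac (p e).
Proof.
have /fin_all_exists [d dP] : forall e : E, exists d : {mpoly K[n + n]},
    d != 0 /\ exists p, tofrac d * gcoef e v = tofrac p.
  by move=> e; have [d d0 [p pE]] := fraction_clear (gcoef e v); exists d; eauto.
exists (tofrac (\prod_e d e)).
  by rewrite tofrac_eq0; apply/prodf_neq0 => e _; case: (dP e).
have H e : exists p, tofrac (\prod_e d e) * gcoef e v = tofrac p.
  have [_ [p pE]] := dP e; exists (p * \prod_(e' | e' != e) d e').
  by rewrite (bigD1 e) //= !tofracM mulrAC -[in RHS]pE.
by have /fin_all_exists [p pP] := H; exists p.
Qed.

(** Once denominators are cleared, all terms have distinct exponents, because terms of
    different coordinates differ modulo 4; the largest one belongs to the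
    leading monomial of one of the coordinates. *)
Lemma has_top_exists (v : A) : v != 0 ->
  exists D, exists M, exists t, [/\ D != 0, t != 0 & has_top M t (D *: v)].
Proof.
move=> v0; have [D D0 [p pE]] := clear_denominators v.
have [e0 pe0] : exists e, p e != 0.
  apply/existsP; apply: contraNT v0 => /existsPn H.
  rewrite [v]gexpand big1 // => e _; have := pE e; have := H e.
  rewrite negbK => /eqP ->; rewrite rmorph0 => /eqP.
  by rewrite mulf_eq0 (negbTE D0) => /eqP ->; rewrite scale0r.
have [e pe0' emax] := @arg_maxP _ _ _ e0 (fun e => p e != 0)
  (fun e => mexp (mlead (p e)) e) pe0.
pose M := mexp (mlead (p e)) e; pose c := mleadc (p e).
exists D, M, (gconst c *: gmon M); split=> //.
  by rewrite scaler_eq0 negb_or gmon_neq0 fmorph_eq0 mleadc_eq0 pe0'.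
split; first by exists c.
have termE e' : tofrac (p e') *: gmon (mexp 0%MM e') =
    \sum_(m <- msupp (p e')) gconst (p e')@_m *: gmon (mexp m e').
  rewrite {1}[p e']mpolyE rmorph_sum scaler_suml; apply: eq_bigr => m _.
  by rewrite -mul_mpolyC rmorphM -scalerA -gmon_mexp.
rewrite [v]gexpand scaler_sumr.
under eq_bigr => e' _ do rewrite scalerA pE termE.
rewrite (bigD1 e) //= (bigD1_seq (mlead (p e))) ?mlead_supp ?msupp_uniq //=.
rewrite -!addrA addrC -addrA subrK.
apply: mspanD.
  rewrite big_seq_cond.
  apply: mspan_sum => m /andP[/msupp_le_mlead le ne]; apply: mspan_gmon.
  rewrite lt_neqAle le_mexp le andbT; apply: contraNneq ne => /(congr1 (@mquo _)).
  by rewrite !mquo_mexp => ->.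
apply: mspan_sum => e' ne; rewrite big_seq_cond; apply: mspan_sum => m.
rewrite andbT => ms; apply: mspan_gmon.
rewrite lt_neqAle; apply/andP; split.
  by apply: contraNneq ne => /(congr1 (@mres _)); rewrite !mres_mexp => ->.
apply: le_trans (emax e' _); first by rewrite le_mexp msupp_le_mlead.
by apply: contraTneq ms => ->; rewrite msupp0.
Qed.

End LeadingTerms.

(** * The upper bound *)

Section UpperBound.

Variables (K : fieldType) (n : nat) (i : K) (iP : 4.-primitive_root i).
Local Notation F := (generic_field K n).
Local Notation A := (generic_alg n iP).
Local Notation X := 'X_{1..n + n}.
Local Notation E := {ffun 'I_(n + n) -> 'I_4}.
Local Notation gconst := (gconst K n).
Local Notation gmon := (@gmon _ n _ iP).

Definition leading (V : {vspace A}) (M : X) :=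
  exists v t, [/\ v \in V, t != 0 & has_top M t v].

(** As long as s has fewer than dim V residues, some nonzero v in V has zero
    coordinates at all of s, and its leading residue is new. *)
Lemma leading_family (V : {vspace A}) j : (j <= \dim V)%N ->
  exists s : seq E, [/\ uniq s, size s = j &
    forall e, e \in s -> exists2 M, mres M = e & leading V M].
Proof.
elim: j => [|j IH] j_le; first by exists [::].
have [s [s_uniq s_size sP]] := IH (ltnW j_le).
pose f (v : A) : 'rV[F]_(size s) := \row_k gcoef (tnth (in_tuple s) k) v.
have f_lin : linear f.
  by move=> c u v; apply/rowP=> k; rewrite !mxE linearP.
pose fL : {linear A -> 'rV[F]_(size s)} := HB.pack f
  (GRing.isSemilinear.Build F A _ _ f (GRing.semilinear_linear f_lin)).
pose U := (V :&: lker (linfun fL))%VS.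
have U0 : U != 0%VS.
  rewrite -dimv_eq0 -lt0n; have := limg_ker_dim (linfun fL) V.
  have : (\dim (linfun fL @: V) <= j)%N.
    apply: leq_trans (dimvS (subvf _)) _.
    by rewrite dimvf -[X in (X <= _)%N]/(1 * size s)%N mul1n s_size.
  by rewrite -/U; lia.
have vU := memv_pick U; set v := vpick U in vU.
have v0 : v != 0 by rewrite vpick0.
have [vV /eqP] : v \in V /\ linfun fL v == 0.
  by move: vU; rewrite memv_cap memv_ker => /andP[].
rewrite lfunE => /rowP fv0.
have [D [M [t [D0 t0 top]]]] := has_top_exists v0.
exists (mres M :: s); split; rewrite /= ?s_size ?s_uniq ?andbT //.
  apply/negP=> Ms; move/eqP: t0; apply; apply: has_top_coef_eq0 top _.
  rewrite linearZ /=; have /tnthP[k ->] : mres M \in in_tuple s by [].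
  by have := fv0 k; rewrite !mxE => ->; rewrite mulr0.
move=> e /predU1P[->|/sP //]; exists M => //.
by exists (D *: v), t; split; rewrite ?memvZ.
Qed.

Definition monomial_at (M : X) (t : A) := exists2 c, c != 0 & t = gconst c *: gmon M.

Lemma monomial_at_top M (t v : A) : t != 0 -> has_top M t v -> monomial_at M t.
Proof.
move=> t0 [[c tE] _]; exists c => //; apply: contraNneq t0 => c0.
by rewrite tE c0 rmorph0 scale0r.
Qed.

Lemma monomial_at_neq0 M t : monomial_at M t -> t != 0.
Proof.
by case=> c c0 ->; rewrite scaler_eq0 negb_or fmorph_eq0 c0 gmon_neq0.
Qed.

Let i_neq0 : i != 0.
Proof.
apply/eqP=> i0; have := prim_expr_order iP; rewrite i0 expr0n /= => /eqP.
by rewrite eq_sym oner_eq0.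
Qed.

Lemma monomial_atM M M' t t' : monomial_at M t -> monomial_at M' t' ->
  monomial_at (M + M')%MM (t * t').
Proof.
move=> [c c0 ->] [c' c0' ->]; rewrite gconst_gmonM; eexists; last reflexivity.
by rewrite !mulf_neq0 // invr_eq0 expf_eq0 (negbTE i_neq0) andbF.
Qed.

Definition mvec (m : X) : 'rV[int]_(n + n) := \row_j (m j)%:Z.
(** Its form gives the exponent of i by which two monomials commute; see
    mxform_symp. *)
Definition symp : 'M[int]_(n + n) := block_mx 0 1%:M (- 1%:M) 0.

Lemma symp_antisym : symp^T = - symp.
Proof. by rewrite tr_block_mx opp_block_mx !trmx0 linearN /= trmx1 !oppr0 opprK. Qed.

Lemma mxform_symp m m' :
  mxform symp (mvec m) (mvec m') = (gpair m' m)%:Z - (gpair m m')%:Z.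
Proof.
rewrite /mxform -[mvec m]hsubmxK mul_row_block !mulmx0 mulmx1 mulmxN mulmx1 add0r addr0.
rewrite -[mvec m']hsubmxK tr_row_mx mul_row_col !mxE /gpair.
rewrite -!natz !natr_sum -sumrN addrC; congr (_ + _); apply: eq_bigr => j _.
  by rewrite !mxE natrM !natz mulrC.
by rewrite !mxE natrM !natz mulNr.
Qed.

Let zF := gconst i.
Let zFP : 4.-primitive_root zF. Proof. exact: generic_prim_root. Qed.

Let z2 : zF ^+ 2 = -1. Proof. exact: primitive4_sqr. Qed.

Lemma monomial_comm M M' t t' r : monomial_at M t -> monomial_at M' t' ->
  (mxform symp (mvec M) (mvec M') %% 4)%Z = r%:Z -> t * t' = zF ^+ r *: (t' * t).
Proof.
move=> [c _ ->] [c' _ ->]; rewrite mxform_symp => Er.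
rewrite !gconst_gmonM scalerA addmC; congr (_ *: _).
rewrite -rmorphXn -rmorphM; congr (gconst _).
rewrite mulrCA [c' * c]mulrC; congr (_ * _).
apply: (mulIf (expf_neq0 (gpair M M') i_neq0)); rewrite mulVf ?expf_neq0 //.
apply: (mulIf (expf_neq0 (gpair M' M) i_neq0)); rewrite mul1r.
rewrite mulrAC mulfVK ?expf_neq0 // -exprD; apply/eqP.
by rewrite (eq_prim_root_expr iP); move: Er; lia.
Qed.

Lemma kummer_gcoef (V : {vspace A}) v e : kummer_space V -> v \in V ->
  e != mres 0%MM -> gcoef e (v ^+ 4) = 0.
Proof.
move=> kV /kV /vlineP[c ->] ne; rewrite linearZ /= -(gmon0 n iP) gcoef_mon.
by rewrite eq_sym (negbTE ne) mul0r mulr0.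
Qed.

Lemma mres0P (M : X) : mres M = mres 0%MM -> forall j, (M j %% 4 = 0)%N.
Proof. by move=> /ffunP EM j; rewrite -mresE EM mresE mnmE. Qed.

Lemma has_top_jord (M M' : X) (t t' v v' : A) :
  has_top M t v -> has_top M' t' v' -> has_top (M + M')%MM (jord t t') (jord v v').
Proof.
move=> h h'; apply: has_topD; first exact: has_topM.
by rewrite addmC; apply: has_topM.
Qed.

Section Leading.

Variable V : {vspace A}.
Hypotheses (K_char0 : [pchar K] =i pred0) (V_kummer : kummer_space V).

Let F_char0 : [pchar F] =i pred0.
Proof. by move=> p; rewrite (fmorph_pchar gconst) K_char0. Qed.

Let natF_neq0 m : (0 < m)%N -> m%:R != 0 :> F.
Proof. by move/pcharf0P: F_char0 => ->; rewrite lt0n. Qed.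

(** Elements of F have coordinate 0 at every nonzero residue. *)
Lemma has_top_kummer M (t w : A) : has_top M t w -> t != 0 ->
  (forall phi : {scalar A}, (forall v, v \in V -> phi (v ^+ 4) = 0) -> phi w = 0) ->
  forall j, (M j %% 4 = 0)%N.
Proof.
move=> top t0 phiw; apply: mres0P; apply/eqP; apply: contraNT t0 => ne.
apply/eqP/(has_top_coef_eq0 top); apply: phiw => v vV.
exact: kummer_gcoef V_kummer vV ne.
Qed.

(** Leading monomials t, t' that commute would make the leading part of jord31
    equal to 4 t^3 t', whose exponent is 3 M + M' and must vanish modulo 4. *)
Lemma leading_commute M M' : leading V M -> leading V M' ->
  (mxform symp (mvec M) (mvec M') %% 4)%Z = 0 -> mres M = mres M'.
Proof.
move=> [v [t [vV t0 top]]] [v' [t' [vV' t0' top']]] wE.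
have tM := monomial_at_top t0 top; have tM' := monomial_at_top t0' top'.
have tt' : t * t' = t' * t by rewrite (monomial_comm tM tM' wE) scale1r.
have top31 := has_top_jord (has_topM top top) (has_top_jord top top').
have := has_top_kummer top31; rewrite -expr2 -/(jord31 t t') jord31_comm //.
rewrite scaler_eq0 negb_or natF_neq0 //=.
have := monomial_at_neq0 (monomial_atM (monomial_atM (monomial_atM tM tM) tM) tM').
move=> -> /(_ isT) H.
have {}H j : ((M + M + (M + M'))%MM j %% 4 = 0)%N.
  by apply: H => phi phiV; rewrite -expr2; apply: kummer_jord31 F_char0 phiV _ _ _ _.
apply/ffunP=> j; apply/val_inj; rewrite /= !mresE.
by move: (H j); rewrite !mnmDE; clear; lia.
Qed.

(** Here the leading part of jord22 is 2 t^2 t'^2, with exponent 2 M + 2 M'. *)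
Lemma leading_anticommute M M' : leading V M -> leading V M' ->
  (mxform symp (mvec M) (mvec M') %% 4)%Z = 2 -> forall j, M j = M' j %[mod 2].
Proof.
move=> [v [t [vV t0 top]]] [v' [t' [vV' t0' top']]] wE j.
have tM := monomial_at_top t0 top; have tM' := monomial_at_top t0' top'.
have tt' : t * t' = - (t' * t) by rewrite (monomial_comm tM tM' wE) z2 scaleN1r.
have topC := has_top_jord top top'.
have top22 : has_top (M + M + (M' + M'))%MM (jord22 t t') (jord22 v v').
  apply: has_topD; first exact: has_top_jord (has_topM top top) (has_topM top' top').
  by apply: has_top_eq (has_topM topC topC); apply/mnmP=> k; rewrite !mnmDE; lia.
have := has_top_kummer top22; rewrite jord22_anti // scaler_eq0 negb_or natF_neq0 //=.
have := monomial_at_neq0 (monomial_atM (monomial_atM (monomial_atM tM tM) tM') tM').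
move=> -> /(_ isT) H.
have : ((M + M + (M' + M'))%MM j %% 4 = 0)%N.
  by apply: H => phi phiV; apply: kummer_jord22 F_char0 phiV _ _ _ _.
by rewrite !mnmDE; clear; lia.
Qed.

(** The leading part of jord211 is a multiple of m^2 r l; its scalar
    (1 + z) z^k + (1 - z) = (1 + z) (z^k - z) vanishes only for k = 1 modulo 4. *)
Lemma leading_path M1 M2 M3 : leading V M1 -> leading V M2 -> leading V M3 ->
  (mxform symp (mvec M1) (mvec M2) %% 4)%Z = 1 ->
  (mxform symp (mvec M2) (mvec M3) %% 4)%Z = 1 ->
  (mxform symp (mvec M1) (mvec M3) %% 4)%Z = 1 \/
  forall j, ((M1 j + 2 * M2 j + M3 j) %% 4 = 0)%N.
Proof.
move=> [u [l [uV l0 lT]]] [v [m [vV m0 mT]]] [w [r [wV r0 rT]]] lm mr.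
have lM := monomial_at_top l0 lT; have mM := monomial_at_top m0 mT.
have rM := monomial_at_top r0 rT.
pose k := `|(mxform symp (mvec M1) (mvec M3) %% 4)%Z|%N.
have lrE : (mxform symp (mvec M1) (mvec M3) %% 4)%Z = k by rewrite /k gez0_abs ?modz_ge0.
have [k1|k1] := eqVneq k 1%N; first by left; rewrite lrE k1.
right.
have top211 : has_top (M2 + M2 + (M1 + M3))%MM (jord211 m l r) (jord211 v u w).
  apply: has_topD; first exact: has_top_jord (has_topM mT mT) (has_top_jord lT rT).
  apply: has_top_eq (has_top_jord (has_top_jord mT lT) (has_top_jord mT rT)).
  by apply/mnmP=> j; rewrite !mnmDE addnACA.
have lmE := monomial_comm lM mM lm; have mrE := monomial_comm mM rM mr.
have lrC := monomial_comm lM rM lrE.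
rewrite !expr1 in lmE mrE.
have := has_top_kummer top211; rewrite (jord211_quasi z2 lmE mrE lrC).
have mmrl := monomial_at_neq0 (monomial_atM (monomial_atM (monomial_atM mM mM) rM) lM).
rewrite scaler_eq0 negb_or mmrl andbT mulf_neq0 ?natF_neq0 //.
  move=> /(_ isT) H j.
  have : ((M2 + M2 + (M1 + M3))%MM j %% 4 = 0)%N.
    by apply: H => phi phiV; apply: kummer_jord211 F_char0 phiV _ _ _ _ _ _.
  by rewrite !mnmDE; clear; lia.
have z_k : zF ^+ k != zF.
  rewrite -[X in _ != X]expr1 (eq_prim_root_expr zFP) /=.
  by move: k1 lrE; clear; lia.
have z1 : 1 + zF != 0.
  apply: contraTneq isT => /eqP; rewrite addrC addr_eq0 => /eqP z1.
  by have := prim_order_dvd zFP 2; rewrite z1 sqrrN expr1n eqxx.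
have -> : (1 + zF) * zF ^+ k + (1 - zF) = (1 + zF) * (zF ^+ k - zF).
  by rewrite mulrBr; congr (_ + _); rewrite mulrDl mul1r -expr2 z2 opprD opprK addrC.
apply: mulf_neq0; first exact: z1.
rewrite subr_eq0; exact: z_k.
Qed.

Lemma leading_kummer_family (I : finType) (M : I -> X) :
  injective (fun x => mres (M x)) -> (forall x, leading V (M x)) ->
  kummer_family symp (fun x => mvec (M x)).
Proof.
move=> M_inj lead; split=> [x y ne wE|x y wE|x y z xy yz].
- by move/eqP: ne; apply; apply: M_inj; apply: leading_commute wE.
- apply/rowP=> j; rewrite !mxE; apply/eqP.
  rewrite -subr_eq0 -rmorphB /= intr_F2_eq0.
  by have := leading_anticommute (lead x) (lead y) wE j; lia.
case: (leading_path (lead x) (lead y) (lead z) xy yz) => H; [by left|right=> j].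
by rewrite !mxE; have := H j; lia.
Qed.

Lemma kummer_space_dim_le : (\dim V <= 4 * n + 1)%N.
Proof.
rewrite leqNgt; apply/negP=> /leading_family [s [s_uniq s_size sP]].
pose k := (4 * n + 1).+1.
have /fin_all_exists [M MP] : forall x : 'I_k,
    exists M, mres M = tnth (Tuple (introT eqP s_size)) x /\ leading V M.
  move=> x; have [|M] := sP (tnth (Tuple (introT eqP s_size)) x); first exact: mem_tnth.
  by exists M.
have M_inj : injective (fun x => mres (M x)).
  move=> x y /=; have [-> _] := MP x; have [-> _] := MP y.
  move/eqP; rewrite !(tnth_nth (mres 0%MM)) nth_uniq ?s_size ?ltn_ord //.
  by move/eqP/val_inj.
have fam := leading_kummer_family M_inj (fun x => (MP x).2).
have := kummer_family_card symp_antisym _ fam.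
by rewrite card_ord /k; lia.
Qed.

End Leading.

End UpperBound.

(** * A Kummer space of dimension 4 n + 1 *)

Section KummerTwist.

Variables (F : fieldType) (z : F) (A : falgType F) (x y : A) (a b : F).
Hypotheses (z2 : z ^+ 2 = -1) (x4 : x ^+ 4 = a%:A) (y4 : y ^+ 4 = b%:A).
Hypothesis xy : x * y = z *: (y * x).

Local Notation ev := (horner_alg x).

(** Moving y past a polynomial in x substitutes z^-1 x = - z x for x. *)
Lemma twist_mul p : y * ev p = ev (p \Po (- z *: 'X)) * y.
Proof.
have yx : y * x = - z *: (x * y).
  by rewrite xy scalerA mulNr -expr2 z2 opprK scale1r.
elim/poly_ind: p => [|p c IH]; first by rewrite comp_poly0 !rmorph0 mulr0 mul0r.
rewrite comp_polyD comp_polyM comp_polyX comp_polyC !rmorphD !rmorphM /=.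
rewrite linearZ /= horner_algX horner_algC [LHS]mulrDr [y * (_ * _)]mulrA IH.
rewrite [RHS]mulrDl -[_ * y * x]mulrA yx -!scalerAr -!scalerAl !mulrA; congr (_ + _).
  by rewrite mul1r -!(scalerAr, scalerAl).
by rewrite mulr1 mul1r.
Qed.

Lemma horner_alg_period q : ev (q \Po 'X^4) = (q.[a])%:A.
Proof.
elim/poly_ind: q => [|p c IH]; first by rewrite comp_poly0 horner0 rmorph0 scale0r.
rewrite comp_polyD comp_polyM comp_polyX comp_polyC rmorphD rmorphM /= IH.
rewrite rmorphXn /= horner_algX horner_algC x4 -scalerAr mulr1 scalerA -scalerDl.
by rewrite hornerMXaddC mulrC.
Qed.

Definition cubic (R : comNzRingType) (f0 f1 f2 f3 t : R) : R :=
  f0 + f1 * t + f2 * t ^+ 2 + f3 * t ^+ 3.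

Lemma cubic_norm (R : comNzRingType) (f0 f1 f2 f3 t : R) :
  cubic f0 f1 f2 f3 t * cubic f0 f1 f2 f3 (- t) =
  (f0 ^+ 2 + (f2 ^+ 2 - 2%:R * f1 * f3) * t ^+ 4)
    + t ^+ 2 * (2%:R * f0 * f2 - f1 ^+ 2 - f3 ^+ 2 * t ^+ 4).
Proof. by rewrite /cubic; ring. Qed.

Lemma horner_alg_cubic (f0 f1 f2 f3 : F) :
  ev (cubic f0%:P f1%:P f2%:P f3%:P 'X) * y =
  f0 *: (x ^+ 0 * y ^+ 1) + f1 *: (x ^+ 1 * y ^+ 1) + f2 *: (x ^+ 2 * y ^+ 1)
    + f3 *: (x ^+ 3 * y ^+ 1).
Proof.
rewrite /cubic !(rmorphD, rmorphM, rmorphXn) /= !horner_algC !horner_algX.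
by rewrite !mulrDl -!scalerAl !mul1r.
Qed.

(** The conjugates of f are f(x), f(- z x), f(- x), f(z x); cubic_norm groups
    opposite arguments, and their product is a polynomial in x^4. *)
Lemma twist_kummer (f0 f1 f2 f3 : F) :
  exists c, (ev (cubic f0%:P f1%:P f2%:P f3%:P 'X) * y) ^+ 4 = c%:A.
Proof.
set f := cubic _ _ _ _ _; pose s p := p \Po (- z *: 'X).
have y2 p : y * y * ev p = ev (s (s p)) * (y * y).
  by rewrite -mulrA twist_mul mulrA twist_mul -mulrA.
have E4 : (ev f * y) ^+ 4 = ev (f * s f * s (s (f * s f))) * y ^+ 4.
  rewrite -[4%N]/(2 * 2)%N !exprM !expr2.
  have -> : ev f * y * (ev f * y) = ev (f * s f) * (y * y).
    by rewrite -mulrA [y * (_ * _)]mulrA twist_mul -/(s f) rmorphM !mulrA.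
  by rewrite -mulrA (mulrA (y * y) (ev _)) y2 [in RHS]rmorphM !mulrA.
have cubicP q r : cubic f0%:P f1%:P f2%:P f3%:P q \Po r =
                  cubic f0%:P f1%:P f2%:P f3%:P (q \Po r).
  by rewrite /cubic !(rmorphD, rmorphM, rmorphXn) /= !comp_polyC.
have sX : s 'X = - z *: 'X by rewrite /s comp_polyX.
have ssX : s (- z *: 'X) = - 'X.
  by rewrite /s linearZ /= comp_polyX scalerA mulrNN -expr2 z2 scaleN1r.
have sssX : s (- 'X) = - (- z *: 'X) by rewrite /s linearN /= comp_polyX.
have sM p q : s (p * q) = s p * s q by rewrite /s comp_polyM.
pose h : {poly F} := (f0%:P ^+ 2 + (f2%:P ^+ 2 - 2%:R * f1%:P * f3%:P) * 'X) ^+ 2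
  - 'X * (2%:R * f0%:P * f2%:P - f1%:P ^+ 2 - f3%:P ^+ 2 * 'X) ^+ 2.
have norm : f * s f * s (s (f * s f)) = h \Po 'X^4.
  rewrite !sM /f /s !cubicP -!/(s _) sX ssX sssX mulrACA !cubic_norm.
  have -> : (- z *: 'X) ^+ 4 = 'X^4 :> {poly F}.
    by rewrite exprZn -[4%N]/(2 * 2)%N exprM sqrrN z2 sqrrN expr1n scale1r.
  have -> : (- z *: 'X) ^+ 2 = - 'X^2 :> {poly F}.
    by rewrite exprZn sqrrN z2 scaleN1r.
  rewrite /h !(rmorphB, rmorphD, rmorphM, rmorphXn, rmorph_nat) /= !comp_polyC comp_polyX.
  ring.
exists (h.[a] * b); rewrite E4 norm horner_alg_period y4.
by rewrite -scalerAl mul1r scalerA.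
Qed.

End KummerTwist.

Section KummerTensorStep.

Variables (F : fieldType) (z : F) (zP : 4.-primitive_root z) (a b : F) (B : falgType F).
Local Notation S := (symbol_alg zP a b).
Local Notation T := (tensor S B).
Local Notation x := (symbol_x zP a b).
Local Notation y := (symbol_y zP a b).

Definition xpoly_y (u : 'rV[F]_4) : S := \sum_j u 0 j *: symbol_mon zP a b j 1.

Lemma xpoly_y_linear : linear xpoly_y.
Proof.
move=> c u v; rewrite /xpoly_y scaler_sumr -big_split; apply: eq_bigr => j _.
by rewrite !mxE /= scalerDl scalerA.
Qed.

Lemma xpoly_yE u (k l : 'I_4) : (xpoly_y u : 'M[F]_4) k l = (l == 1%N :> nat)%:R * u 0 k.
Proof.
have monE (j : 'I_4) : symbol_mon zP a b j 1 = delta_mx j (inord 1) :> 'M[F]_4.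
  by have := symbol_monE zP a b j (inord 1); rewrite inordK.
rewrite /xpoly_y summxE (bigD1 k) //= big1 => [|j /negbTE nj].
  by rewrite addr0 mxE monE mxE eqxx mulrC -val_eqE /= inordK.
by rewrite mxE monE mxE eq_sym nj mulr0.
Qed.

Lemma xpoly_y_kummer u : exists c, xpoly_y u ^+ 4 = c%:A.
Proof.
have [c] := twist_kummer (primitive4_sqr zP) (symbol_x4 zP a b) (symbol_y4 zP a b)
  (symbol_xy zP a b) (u 0 ord0) (u 0 (lift ord0 ord0))
  (u 0 (lift ord0 (lift ord0 ord0))) (u 0 (lift ord0 (lift ord0 (lift ord0 ord0)))).
rewrite horner_alg_cubic => cE; exists c; rewrite -cE; congr (_ ^+ 4).
rewrite /xpoly_y !big_ord_recl big_ord0 addr0 !addrA.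
by rewrite !symbol_monXY.
Qed.

Lemma xpoly_y_x u : x * xpoly_y u = z *: (xpoly_y u * x).
Proof.
rewrite mulr_sumr mulr_suml scaler_sumr; apply: eq_bigr => j _.
rewrite /symbol_x -(scalerAr (u 0 j)) -(scalerAl (u 0 j)) !symbol_monM.
rewrite !scalerA mul0n muln1 expr0 invr1.
rewrite [(1 + j)%N]addnC; congr (_ * _ *: _); rewrite mulr1 expr1 mulrAC divff ?mul1r //.
apply/eqP=> z0; have := primitive4_sqr zP; rewrite z0 expr0n /= => /eqP.
by rewrite eq_sym oppr_eq0 oner_eq0.
Qed.

Fact kummer_left_linear : linear (fun u => tens (xpoly_y u) 1 : T).
Proof. by move=> c u v; rewrite xpoly_y_linear tens_linearl. Qed.

Fact kummer_right_linear : linear (fun v => tens x v : T).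
Proof. exact: tens_linearr. Qed.

Definition kummer_left : {linear 'rV[F]_4 -> T} :=
  HB.pack (fun u => tens (xpoly_y u) 1 : T)
    (GRing.isSemilinear.Build F 'rV[F]_4 T _ _
      (GRing.semilinear_linear kummer_left_linear)).
Definition kummer_right : {linear B -> T} :=
  HB.pack (fun v => tens x v : T)
    (GRing.isSemilinear.Build F B T _ _ (GRing.semilinear_linear kummer_right_linear)).

Definition kummer_step (V : {vspace B}) : {vspace T} :=
  (linfun kummer_left @: fullv + linfun kummer_right @: V)%VS.

Lemma kummer_step_kummer V : kummer_space V -> kummer_space (kummer_step V).
Proof.
move=> kV w /memv_addP[_ /memv_imgP[u _ ->] [_ /memv_imgP[v vV ->] ->]].
rewrite !lfunE /= /kummer (@expr4_quasi _ T z); last 2 first.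
- exact: primitive4_sqr.
- by rewrite [LHS]tensM [X in _ *: X]tensM mulr1 mul1r xpoly_y_x tensZl.
have tensX (s : S) (r : B) k : (tens s r : T) ^+ k = tens (s ^+ k) (r ^+ k).
  elim: k => [|k IH]; first by rewrite !expr0.
  by rewrite exprS IH [LHS]tensM -!exprS.
have [c pE] := xpoly_y_kummer u; have /vlineP [c' vE] := kV v vV.
rewrite !tensX pE vE symbol_x4 expr1n (tensZl c) (tensZl a) (tensZr c') scalerA -scalerDl.
by apply/vlineP; exists (c + a * c').
Qed.

Let lker0_dim (U W : vectType F) (f : 'Hom(U, W)) (V : {vspace U}) :
  (forall u, f u = 0 -> u = 0) -> \dim (f @: V) = \dim V.
Proof.
move=> f0; apply: limg_dim_eq; apply/eqP; rewrite -subv0.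
by apply/subvP=> u; rewrite memv_cap memv_ker memv0 => /andP[_ /eqP/f0->].
Qed.

(** The two summands meet in 0, because xpoly_y u only involves the monomials
    x^k y while x has no such component. *)
Lemma kummer_step_dim V : \dim (kummer_step V) = (4 + \dim V)%N.
Proof.
have x_coord (k : 'I_4) : (x : 'M[F]_4) k 1 = 0.
  by have := symbol_monE zP a b 1 0; rewrite /symbol_x => ->; rewrite mxE andbF.
have x0 : x != 0.
  apply/eqP=> /(congr1 (fun w : S => (w : 'M[F]_4) 1 0)).
  have := symbol_monE zP a b 1 0; rewrite /symbol_x => ->; rewrite !mxE !eqxx.
  by move/eqP; rewrite oner_eq0.
have p0 u : (forall k, (xpoly_y u : 'M[F]_4) k 1 = 0) -> u = 0.
  by move=> H; apply/rowP=> k; have := H k; rewrite xpoly_yE mul1r mxE.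
rewrite dimv_disjoint_sum.
  rewrite !lker0_dim ?dimvf //.
  - by move=> v; rewrite lfunE /= => /eqP; apply: contraTeq => v0; apply: tens_neq0.
  move=> u; rewrite lfunE /= => /eqP H; apply: p0 => k.
  suff -> : xpoly_y u = 0 by rewrite mxE.
  by apply: contraTeq H => u0; apply: tens_neq0 => //; apply: oner_neq0.
apply/eqP; rewrite -subv0; apply/subvP=> w; rewrite memv_cap memv0.
case/andP=> /memv_imgP[u _ ->] /memv_imgP[v _]; rewrite !lfunE /= => E.
suff -> : u = 0 by rewrite -[X in X == _]/(kummer_left 0) linear0.
apply: p0 => k.
pose g (s : S) (r : B) : B := (s : 'M[F]_4) k 1 *: r.
have gP : bilin g.
  split=> [r|s] c s1 s2; rewrite /g; first by rewrite !mxE scalerDl scalerA.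
  by rewrite scalerDr !scalerA mulrC.
have := congr1 (tens_lift g) E; rewrite !tens_liftE // /g x_coord scale0r.
by move/eqP; rewrite scaler_eq0 oner_eq0 orbF => /eqP.
Qed.

End KummerTensorStep.

Lemma kummer_space_exists (F : fieldType) (z : F) (zP : 4.-primitive_root z) n
    (a b : 'I_n -> F) :
  exists2 V : {vspace symbol_prod zP a b}, kummer_space V & \dim V = (4 * n + 1)%N.
Proof.
elim: n a b => [|n IH] a b.
  exists fullv; last by rewrite dimvf.
  by move=> v _; apply/vlineP; exists (v ^+ 4); rewrite [RHS]mulr1.
have [V kV dV] := IH (fun j => a (lift ord0 j)) (fun j => b (lift ord0 j)).
exists (kummer_step zP (a ord0) (b ord0) V); first exact: kummer_step_kummer.
by rewrite [LHS]kummer_step_dim dV; lia.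
Qed.

Theorem theorem6p4 (n : nat) (K : fieldType) (i : K) (n_gt0 : (0 < n)%N)
    (char0 : [pchar K]%R =i pred0) (iP : (4.-primitive_root i)%R) :
  (exists2 V : {vspace generic_alg n iP},
     kummer_space V & \dim V = (4 * n + 1)%N) /\
  (forall V : {vspace generic_alg n iP},
     kummer_space V -> (\dim V <= 4 * n + 1)%N).
Proof.
split; first exact: kummer_space_exists.
by move=> V kV; apply: kummer_space_dim_le.
Qed.
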